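(* Let $\mathcal K_2^\infty\subset\mathbb R^2$ be the four-corner Cantor set. For every $u>0$ there are constants $C_u$ and $N_u$ such that, for every integer $N\geq N_u$, $$\operatorname{Fav}\big(\mathcal N_{4^{-N}}(\mathcal K_2^\infty)\big)\leq C_uN^{-1/5+u}.$$
   Context: For $\theta\in\mathbb S^{1}$ and $x\in\mathbb R^2$ let $\pi_\theta(x)=x\cdot\theta$. Let $\sigma^{1}$ be the normalized arclength measure on $\mathbb S^1$ and $\mathcal H^1$ the one-dimensional Hausdorff (Lebesgue) measure. The Favard length of $E\subset\mathbb R^2$ is $\operatorname{Fav}(E)=\int_{\mathbb S^{1}}\mathcal H^1(\pi_\theta(E))\,d\sigma^{1}(\theta)$. For $\delta>0$, $\mathcal N_\delta(E)=\{x\in\mathbb R^2:\operatorname{dist}(x,E)<\delta\}$. The four-corner Cantor set: put $A=\{0,3\}$, $A^N=4^{-1}A+4^{-2}A+\cdots+4^{-N}A$ (Minkowski sum), $\mathcal K_2^N=(A^N\times A^N)+[0,4^{-N}]^2$, and $\mathcal K_2^\infty=\bigcap_{N\geq1}\mathcal K_2^N$. *)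

(* Defs.v *)
From HB Require Import structures.
From mathcomp Require Import all_boot all_order all_algebra.
From mathcomp Require Import all_classical all_reals all_analysis.

Set Implicit Arguments.
Unset Strict Implicit.
Unset Printing Implicit Defensive.

Import Order.TTheory GRing.Theory Num.Theory.
Import numFieldNormedType.Exports.

Local Open Scope classical_set_scope.
Local Open Scope ring_scope.

Definition minkowski_sum (V : zmodType) (A B : set V) : set V :=
  [set a + b | a in A & b in B].

Section plane.
Variable R : realType.
Implicit Types (x y theta : R * R) (E : set (R * R)).

Definition pi_theta theta x : R := x.1 * theta.1 + x.2 * theta.2.

(* The library's norm on [R * R] is the sup norm, hence the explicit
   Euclidean distance. *)
Definition eucl_dist x y : R :=
  Num.sqrt ((x.1 - y.1) ^+ 2 + (x.2 - y.2) ^+ 2).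

(* Extended-real valued, so that the distance to the empty set is +oo
   (the real-valued [inf] of the empty set is 0). *)
Definition dist_to_set x E : \bar R :=
  ereal_inf [set (eucl_dist x y)%:E | y in E].

Definition nbhd (delta : R) E : set (R * R) :=
  [set x | (dist_to_set x E < delta%:E)%E].

Definition unit_circle : set (R * R) := [set x | x.1 ^+ 2 + x.2 ^+ 2 = 1].

Definition circle_param (t : R) : R * R := (cos t, sin t).

Lemma twopi_gt0 : 0 < 2 * pi :> R.
Proof. by rewrite mulr_gt0 ?pi_gt0. Qed.

(* [circle_param] has unit speed and runs once around the circle on [0, 2 pi],
   so this is arclength divided by 2 pi. *)
Definition sigma1 : set (R * R) -> \bar R :=
  pushforward (uniform_prob twopi_gt0) circle_param.

(* On the line, the 1-dimensional Hausdorff measure is the Lebesgue measure;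
   [lebesgue_measure] extends to all sets as an outer measure. *)
Definition Fav E : \bar R :=
  (\int[sigma1]_(theta in unit_circle) lebesgue_measure (pi_theta theta @` E))%E.

Definition digits : set R := [set 0; 3].

Definition cantor_corners (N : nat) : set R :=
  \big[@minkowski_sum R/[set 0]]_(1 <= k < N.+1)
     [set 4 ^- k * a | a in digits].

Definition four_corner (N : nat) : set (R * R) :=
  minkowski_sum (cantor_corners N `*` cantor_corners N)
    (`[0, 4 ^- N] `*` `[0, 4 ^- N]).

Definition four_corner_cantor : set (R * R) :=
  \bigcap_(N in [set n | (1 <= n)%N]) four_corner N.

End plane.

(* Main.v *)
(* After scaling, the projection of the N-th stage in a direction of slope t with
   |t| <= 1 is governed by the points 4^-n lam(w), w a word of length n, and
   |sum_w exp (i y lam(w))|^2 = 4^n Q_n(y) Q_n(t y) with the Riesz products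
   Q_n(y) = prod_(j < n) (1 + cos (4^j y)).

   Fix K. If some level n has more than 2 K 4^n pairs of words at bounded
   distance, then a proportion at least c/K of the words sits below stacks of
   more than K nearly coinciding words (a stopping-time argument), a Vitali
   selection covers these cheaply, and iterating about K log K times covers the
   whole projection by intervals of total length O(1/K).

   Otherwise the energies int_0^1 Q_n(y) Q_n(t y) dy are O(K) for all n <= N, so
   that most blocks int_(4^-r)^1 Q_n(y) Q_n(t y) dy are O(K r / N). With 4^r ~ K
   the high frequency part M of the integrand has mass at least 1/4 on [4^-r, 1].
   The low frequency part is bounded below by
   64^-r sin^2 (4^r y / 2) sin^2 (4^r t y / 2), hence M must concentrate
   near the zeros of the sines. In the coordinates (y, t y) the weight M is a product
   measure, so on average over t such a concentration at depth J costs a factor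
   J 2^-J. Summing over K = 2^k <= 2^k0 with N ~ 16^k0 bounds the Favard length
   at stage about 32^k0 by k0^2 2^-k0. *)

Require Import Defs.
From mathcomp Require Import all_boot all_order all_algebra.
From mathcomp Require Import all_classical all_reals all_analysis.
From mathcomp Require Import measurable_realfun.
From mathcomp Require Import zify ring lra.

Set Implicit Arguments.
Unset Strict Implicit.
Unset Printing Implicit Defensive.

Import Order.TTheory GRing.Theory Num.Theory.
Import numFieldNormedType.Exports.
Local Open Scope classical_set_scope.
Local Open Scope ring_scope.

(** The exponent comes from one balance. With [4^r ~ K] the low frequency part costs [64^r ~ K^3],
    the energy bound costs another [K], and depth [J] costs [16^J]. For [K = 2^k] the choice
    [J = k0 - k] makes [K^4 16^J] equal to [16^k0], so one number of blocks serves every [k], and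
    each [k] contributes [2^-k * J 2^-J], which is of order at most [k0 2^-k0]. The iteration
    multiplies the stage by about [2^k0], and [1/5 = log 2 / log 32].

    Exceptional directions are never handled as sets. In a direction whose pair counts stay below
    the threshold for [2^k], the energy argument yields an inequality [1 <= summand k0 k t]. The
    covering length is therefore dominated, direction by direction, by an explicit measurable
    function, and only that function is integrated.

    The stopping-time argument meets pairs of subtrees hanging below two different close words, that
    is, pair counts with a translation. These are controlled because a translation cannot increase
    the number of coincidences by more than a constant factor. *)

Notation digit := (bool * bool)%type.

(** * Words, their positions, and counts of close pairs *)

Fixpoint words (n : nat) : seq (seq digit) :=
  if n is m.+1 then [seq d :: w | d <- enum {: digit}, w <- words m] else [:: [::]].

Lemma mem_words n w : (w \in words n) = (size w == n).
Proof.
elim: n w => [|n IH] [|d w] //=.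
- by apply/allpairsP => -[[? ?] []].
- rewrite eqSS -IH; apply/allpairsP/idP => [[[a b] /= [_ + [_ ->]]] //|wn].
  by exists (d, w); rewrite /= mem_enum.
Qed.

Lemma size_words n : size (words n) = (4 ^ n)%N.
Proof.
by elim: n => //= n IH; rewrite size_allpairs IH -cardE card_prod card_bool expnS.
Qed.

Section big_words.
Variables (V : Type) (idx : V) (op : Monoid.com_law idx).
Local Notation "\bigop_ ( i <- r ) E" := (\big[op/idx]_(i <- r) E)
  (at level 36, E at level 36, i, r at level 50).

Lemma big_words0 (F : seq digit -> V) : \bigop_(w <- words 0) F w = F [::].
Proof. by rewrite big_seq1. Qed.

Lemma big_wordsS n (F : seq digit -> V) : \bigop_(w <- words n.+1) F w =
  \big[op/idx]_(d : digit) \bigop_(w <- words n) F (d :: w).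
Proof. by rewrite /= big_allpairs_dep /= big_enum. Qed.

Lemma big_words_cat m n (F : seq digit -> V) : \bigop_(w <- words (m + n)) F w =
  \bigop_(u <- words m) \bigop_(v <- words n) F (u ++ v).
Proof.
elim: m F => [|m IH] F; first by rewrite big_words0.
by rewrite addSn !big_wordsS; apply: eq_bigr => d _; rewrite IH.
Qed.

Lemma big_words1 (F : seq digit -> V) :
  \bigop_(w <- words 1) F w = \big[op/idx]_(d : digit) F [:: d].
Proof. by rewrite big_wordsS; apply: eq_bigr => d _; rewrite big_words0. Qed.

End big_words.

Lemma sum_digit (V : nmodType) (F : digit -> V) :
  \sum_(d : digit) F d =
  (F (true, true) + F (true, false)) + (F (false, true) + F (false, false)).
Proof.
transitivity (\sum_(d : digit) F (d.1, d.2)); first by apply: eq_bigr => -[].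
by rewrite -(pair_bigA _ (fun a b => F (a, b))) /= !big_bool.
Qed.

(* AM-GM on the sizes of the fibres of [f] and [g]. *)
Lemma pairs_eq_le (T V : eqType) (s : seq T) (f g : T -> V) :
  (2 * \sum_(x <- s) \sum_(y <- s) (f x == g y) <=
   \sum_(x <- s) \sum_(y <- s) (f x == f y) +
   \sum_(x <- s) \sum_(y <- s) (g x == g y))%N.
Proof.
pose V0 := undup (map f s ++ map g s).
have fib (h h' : T -> V) : {subset map h s <= V0} ->
    (\sum_(x <- s) \sum_(y <- s) (h x == h' y) =
     \sum_(v <- V0) (\sum_(x <- s) (h x == v)) * (\sum_(y <- s) (h' y == v)))%N.
  move=> hV.
  under [RHS]eq_bigr do rewrite big_distrl /=; rewrite [RHS]exchange_big /=.
  apply: eq_big_seq => x xs.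
  have hx : h x \in V0 by apply: hV; apply: map_f.
  rewrite (bigD1_seq (h x)) ?undup_uniq //= eqxx mul1n [X in (_ + X)%N]big1 ?addn0.
    by apply: eq_bigr => y _; rewrite eq_sym.
  by move=> v /negPf vh; rewrite eq_sym vh mul0n.
have fV : {subset map f s <= V0} by move=> v; rewrite mem_undup mem_cat => ->.
have gV : {subset map g s <= V0} by move=> v; rewrite mem_undup mem_cat => ->; rewrite orbT.
rewrite !fib // big_distrr -big_split /=; apply: leq_sum => v _.
by rewrite !mulnn nat_Cauchy.
Qed.

Section words.
Variables (R : realType) (t : R).

(* [4 ^ - n * lam w] is a third of the projection, in the direction (1, t), of the
   corner of the square of generation [n] with address [w] (coarsest digit first). *)
Definition dval (d : digit) : R := d.1%:R + t * d.2%:R.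

Fixpoint lam (w : seq digit) : R :=
  if w is d :: w' then 4 ^+ size w' * dval d + lam w' else 0.

Lemma lam_cat u v : lam (u ++ v) = 4 ^+ size v * lam u + lam v.
Proof.
elim: u => [|d u IH] /=; first by rewrite mulr0 add0r.
by rewrite IH size_cat exprD; ring.
Qed.

Lemma lam_rcons u d : lam (rcons u d) = 4 * lam u + dval d.
Proof. by rewrite -cats1 lam_cat /= expr1 expr0 mul1r addr0. Qed.

Definition close (v u : seq digit) : bool := `|lam v - lam u| <= 1.

Lemma close_sym v u : close v u = close u v.
Proof. by rewrite /close distrC. Qed.

Definition npairs (n : nat) : nat :=
  (\sum_(w <- words n) \sum_(w' <- words n) close w w')%N.

Definition cnt (v : seq digit) : nat :=
  (\sum_(u <- words (size v)) close v u)%N.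

Lemma floor_pairs_le n q :
  (\sum_(w <- words n) \sum_(w' <- words n)
     (Num.floor (lam w + q) == Num.floor (lam w' + q)) <= npairs n)%N.
Proof.
apply: leq_sum => w _; apply: leq_sum => w' _.
case: eqP => //= ww'; rewrite /close; suff -> : `|lam w - lam w'| <= 1 by [].
have /andP[a1 a2] := floor_itv (lam w + q); have /andP[b1 b2] := floor_itv (lam w' + q).
move: a1 a2 b1 b2; rewrite ww' intrD /= => a1 a2 b1 b2.
by rewrite ler_norml; apply/andP; split; lra.
Qed.

Lemma floor_shift_pairs_le n (q q' : R) :
  (\sum_(w <- words n) \sum_(w' <- words n)
     (Num.floor (lam w + q) == Num.floor (lam w' + q')) <= npairs n)%N.
Proof.
have /= h := pairs_eq_le (words n) (fun w => Num.floor (lam w + q))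
  (fun w => Num.floor (lam w + q')).
rewrite -(leq_pmul2l (isT : (0 < 2)%N)); apply: leq_trans h _.
by rewrite mul2n -addnn leq_add // floor_pairs_le.
Qed.

(** The floors of [lam w + q] and [lam w'] then differ by -1, 0 or 1, and each case is a coincidence
    of floors after a translation, hence the factor 3. This compares the subtrees below two
    different close words. *)
Lemma shifted_pairs_le n q :
  (\sum_(w <- words n) \sum_(w' <- words n) (`|q + lam w - lam w'| <= 1)%R <=
   3 * npairs n)%N.
Proof.
have H (k : int) := floor_shift_pairs_le n (q + k%:~R) 0.
apply: leq_trans (_ : _ <= \sum_(w <- words n) \sum_(w' <- words n)
  ((Num.floor (lam w + (q + (-1)%:~R)) == Num.floor (lam w' + 0)) +
   (Num.floor (lam w + (q + 0%:~R)) == Num.floor (lam w' + 0)) +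
   (Num.floor (lam w + (q + 1%:~R)) == Num.floor (lam w' + 0))))%N _; last first.
  under eq_bigr do rewrite !big_split; rewrite !big_split /=.
  by rewrite !mulSn addn0 addnA; do 2?[apply: leq_add]; apply: H.
apply: leq_sum => w _; apply: leq_sum => w' _.
case: lerP => //=; rewrite addr0 !addrA; set x := lam w + q; set y := lam w'.
have fl (k : int) : Num.floor (x + k%:~R) = Num.floor x + k.
  by rewrite floorDrz ?intr_int // intrKfloor.
rewrite !fl.
have -> : q + lam w - y = x - y by rewrite /x; ring.
rewrite ler_norml => /andP[h1 h2].
have /andP[a1 a2] := floor_itv x; have /andP[b1 b2] := floor_itv y.
have f1 : (Num.floor x < Num.floor y + 2).
  rewrite -(ltr_int R) intrD /=; move: a1 b2; rewrite intrD /=; lra.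
have f2 : (Num.floor y < Num.floor x + 2).
  rewrite -(ltr_int R) intrD /=; move: b1 a2; rewrite intrD /=; lra.
by move: f1 f2; move: (Num.floor x) (Num.floor y) => a b; lia.
Qed.

Hypothesis t1 : `|t| <= 1.

Lemma dval_bound d d' : `|dval d - dval d'| <= 2.
Proof.
move: t1; rewrite !ler_norml /dval => /andP[? ?].
by case: d => [[] []]; case: d' => [[] []] /=; lra.
Qed.

Lemma dval_le d : `|dval d| <= 2.
Proof. by have := dval_bound d (false, false); rewrite {2}/dval mulr0 addr0 subr0. Qed.

Lemma lam_bound w : `|lam w| <= 2 / 3 * (4 ^+ size w - 1).
Proof.
elim: w => [|d w IH] /=; first by rewrite expr0 normr0 subrr mulr0.
apply: le_trans (ler_normD _ _) _; rewrite normrM ger0_norm ?exprn_ge0 //.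
have := dval_le d; have : 1 <= 4 ^+ size w :> R by rewrite exprn_ege1 // ler1n.
by rewrite exprS; nra.
Qed.

(** The last digits contribute at most 2 to the difference and [(1 + 2) / 4 <= 1], so the threshold
    1 is inherited by prefixes. *)
Lemma close_rcons v u d e : close (rcons v d) (rcons u e) -> close v u.
Proof.
rewrite /close !lam_rcons !ler_norml => /andP[? ?].
have := dval_bound d e; rewrite ler_norml => /andP[? ?].
by apply/andP; split; lra.
Qed.

Lemma close_cat v u x y : size x = size y -> close (v ++ x) (u ++ y) -> close v u.
Proof.
elim: x v u y => [|d x IH] v u [|e y] //=; first by rewrite !cats0.
move=> [xy]; rewrite -!cat_rcons => /(IH _ _ _ xy); exact: close_rcons.
Qed.

End words.

Lemma sum_words1 m : (\sum_(x <- words m) 1 = 4 ^ m)%N.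
Proof. by rewrite sum1_size size_words. Qed.

(** * Stopping time: many pairs force many words with a heavy prefix *)

Section heavy.
Variables (R : realType) (t : R).
Hypothesis t1 : `|t| <= 1.
Local Notation close := (close t).
Local Notation cnt := (cnt t).
Local Notation npairs := (npairs t).

Variable K : nat.

Definition heavy (v : seq digit) : bool := (K < cnt v)%N.

Fixpoint bad (v x : seq digit) : bool :=
  if x is d :: x' then heavy (rcons v d) || bad (rcons v d) x' else false.

Lemma badP v x : bad v x ->
  exists2 l, (0 < l <= size x)%N & heavy (v ++ take l x).
Proof.
elim: x v => [//|d x IH] v /= /orP[h|/IH [l /andP[l0 lx] hl]].
- by exists 1%N; rewrite //= take0 cats1.
- by exists l.+1; rewrite ?ltnS //= -cat_rcons.
Qed.

Lemma cnt_rcons v d : (cnt (rcons v d) <= 4 * cnt v)%N.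
Proof.
rewrite /cnt size_rcons -addn1 big_words_cat big_distrr /=.
apply: leq_sum => u _; rewrite -[4%N]/(2 * 2)%N -card_bool -card_prod -sum1_card.
rewrite big_distrl big_words1 /=; apply: leq_sum => e _; rewrite mul1n cats1.
by case: (boolP (close _ (rcons u e))) => // /(close_rcons t1) ->.
Qed.

Lemma cnt_nil : cnt [::] = 1%N.
Proof. by rewrite /cnt /= big_seq1 /close subrr normr0 ler01. Qed.

(** A word close to [v ++ x] splits as [u ++ y] with [u] close to [v]. Such a [u] only translates
    the comparison of [x] with [y] by [4 ^ m * (lam v - lam u)], so it contributes one shifted pair
    count. *)
Lemma sum_cnt_ext v m :
  (\sum_(x <- words m) cnt (v ++ x) <= cnt v * (3 * npairs m))%N.
Proof.
rewrite big_seq; under eq_bigr => x xm.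
  move: xm; rewrite mem_words => /eqP xm.
  rewrite /cnt size_cat xm big_words_cat.
  over.
rewrite -big_seq /= exchange_big /= /cnt big_distrl /=.
rewrite !big_seq; apply: leq_sum => u; rewrite mem_words => /eqP uv.
have [vu|/negPf vu] := boolP (close v u).
- rewrite mul1n. apply: leq_trans (shifted_pairs_le t m (4 ^+ m * (lam t v - lam t u))).
  rewrite !big_seq; apply: leq_sum => x; rewrite mem_words => /eqP xm.
  rewrite !big_seq; apply: leq_sum => y; rewrite mem_words => /eqP ym.
  rewrite /close !lam_cat xm ym.
  set a := 4 ^+ m * lam t v + lam t x - _; set b := 4 ^+ m * _ + _ - _.
  by have -> : a = b by rewrite /a /b; ring.
- rewrite mul0n leqn0 big_seq big1 // => x; rewrite mem_words => /eqP xm.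
  rewrite big_seq big1 // => y; rewrite mem_words => /eqP ym.
  apply/eqP; rewrite eqb0; apply/negP => /(close_cat t1).
  by rewrite xm ym vu => /(_ erefl).
Qed.

Variable n : nat.
Hypothesis n_min : forall m, (m < n)%N -> (npairs m <= 2 * K * 4 ^ m)%N.

(* The induction goes down the tree of words; a first heavy child has at most
   [4 * K] close words since its parent is not heavy. *)
Lemma sum_cnt_le m v : (size v + m = n)%N -> ~~ heavy v ->
  (\sum_(x <- words m) cnt (v ++ x) <=
   K * 4 ^ m + 24 * K ^ 2 * \sum_(x <- words m) bad v x)%N.
Proof.
elim: m v => [|m IH] v vn hv.
  rewrite !big_words0 /= cats0 muln0 addn0 expn0 muln1.
  by rewrite leqNgt.
rewrite !big_wordsS.
have -> : (K * 4 ^ m.+1 = \sum_(d : digit) K * 4 ^ m)%N.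
  by rewrite sum_nat_const card_prod card_bool expnS; ring.
rewrite big_distrr -big_split /=; apply: leq_sum => d _.
under eq_bigr do rewrite -cat_rcons.
have [hd|hd] := boolP (heavy (rcons v d)).
- apply: leq_trans (_ : _ <= 24 * K ^ 2 * 4 ^ m)%N _; last first.
    rewrite -sum_words1; under [X in (_ <= _ + _ * X)%N]eq_bigr do rewrite orTb.
    by rewrite leq_addl.
  apply: leq_trans (sum_cnt_ext _ _) _.
  have := cnt_rcons v d; move: hv; rewrite /heavy -leqNgt => hv hc.
  (* [4 * K] comes from the parent, 3 from the translation of subtrees, [2 * K] from [n_min]. *)
  apply: leq_trans (_ : _ <= (4 * K) * (3 * (2 * K * 4 ^ m)))%N _; last first.
    by apply/eq_leq; ring.
  apply: leq_mul; first by apply: leq_trans hc _; rewrite leq_pmul2l.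
  by rewrite leq_pmul2l // n_min // -vn addnS ltnS leq_addl.
- by under [X in (_ <= _ + _ * X)%N]eq_bigr do rewrite orFb; apply: IH; rewrite // size_rcons addSnnS.
Qed.

(** The counts on level [n] add up to [npairs n]. The term [K * 4 ^ n] of [sum_cnt_le] absorbs less
    than half of this; the rest is charged to bad words at [24 * K ^ 2] each. *)
Lemma many_bad : (0 < K)%N -> (2 * K * 4 ^ n < npairs n)%N ->
  (4 ^ n < 24 * K * \sum_(x <- words n) bad [::] x)%N.
Proof.
move=> K0 Tn.
have : ~~ heavy [::] by rewrite /heavy cnt_nil -leqNgt.
move=> /(@sum_cnt_le n [::] (erefl n)) /=.
have -> : (\sum_(x <- words n) cnt x = npairs n)%N.
  by apply: eq_big_seq => x; rewrite mem_words /cnt => /eqP ->.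
move=> h; rewrite -(ltn_pmul2l K0).
have : (2 * K * 4 ^ n < K * 4 ^ n + 24 * K ^ 2 * \sum_(x <- words n) bad [::] x)%N.
  exact: leq_trans h.
by rewrite -mulnA mul2n -addnn ltn_add2l => /leq_trans; apply; apply/eq_leq; ring.
Qed.

End heavy.

(** * Vitali selection and covers of the projection *)

Lemma vitali_select (T : eqType) (near : rel T) (rank : T -> nat) (s : seq T) :
  reflexive near ->
  exists D : seq T, [/\ {subset D <= s}, pairwise (fun a b => ~~ near a b) D &
    forall i, i \in s -> exists2 j, j \in D & near i j && (rank j <= rank i)%N].
Proof.
move=> nearxx.
pose le (a b : T) := (rank a <= rank b)%N.
have le_tr : transitive le by move=> a b c; apply: leq_trans.
wlog : s / sorted le s.
  have : sorted le (sort le s) by apply: sort_sorted => a b; apply: leq_total.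
  move=> /[swap] /[apply] -[D [Ds pD H]]; exists D; split => //.
  - by move=> x /Ds; rewrite mem_sort.
  - by move=> i; rewrite -(mem_sort le) => /H.
(* Greedy selection by increasing rank: the element of largest rank comes last and either is near a
   selected one or joins the selection. *)
elim/last_ind: s => [|s i IH]; first by exists [::].
rewrite sorted_pairwise // pairwise_rcons => /andP[/allP si].
rewrite -sorted_pairwise // => /IH [D [Ds pD H]].
have [/hasP[j jD nij]|/hasPn Nn] := boolP (has (near i) D).
- exists D; split => //.
  + by move=> x /Ds xs; rewrite mem_rcons inE xs orbT.
  + move=> k; rewrite mem_rcons inE => /orP[/eqP ->|/H //].
    by exists j => //; rewrite nij; apply: si; apply: Ds.
- exists (i :: D); split.
  + by move=> x; rewrite inE mem_rcons inE => /orP[->//|/Ds ->]; rewrite orbT.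
  + by rewrite /= pD andbT; apply/allP.
  + move=> k; rewrite mem_rcons inE => /orP[/eqP ->|/H [j jD nj]].
      by exists i; rewrite ?mem_head // nearxx /=.
    by exists j => //; rewrite inE jD orbT.
Qed.

Lemma exp4_neq0 (R : numDomainType) n : 4 ^+ n != 0 :> R.
Proof. by rewrite expf_neq0 // pnatr_eq0. Qed.

Lemma eq_ler (R : numDomainType) (x y : R) : x = y -> x <= y.
Proof. by move=> ->. Qed.

Section covers.
Variables (R : realType) (t : R).
Local Notation close := (close t).
Local Notation cnt := (cnt t).
Local Notation npairs := (npairs t).
Local Notation lam := (lam t).

Definition pos (w : seq digit) : R := lam w / 4 ^+ size w.

Lemma close_pos v u : size v = size u -> close v u = (`|pos v - pos u| <= 4 ^- size v).
Proof.
move=> vu; rewrite /close /pos -vu -mulrBl normrM [X in _ * X]ger0_norm ?invr_ge0 ?exprn_ge0 //.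
by rewrite ler_pdivrMr ?exprn_gt0 // mulVf ?exp4_neq0.
Qed.

(* Intervals are given by their centers and radii. The neighborhoods of radius
   [3 / 4 ^ n] decrease with [n], whence [coveredS]. *)
Definition in_cover (s : seq (R * R)) (z : R) : bool :=
  has (fun i : R * R => `|z - i.1| <= i.2) s.

Definition covered (n : nat) (x : R) : Prop :=
  exists s : seq (R * R), [/\ all (fun i : R * R => 0 <= i.2) s, \sum_(i <- s) i.2 <= x &
    forall w z, size w = n -> `|z - pos w| <= 3 / 4 ^+ n -> in_cover s z].

Lemma covered_le n x y : x <= y -> covered n x -> covered n y.
Proof. by move=> xy [s [s0 sx H]]; exists s; split => //; apply: le_trans xy. Qed.

Lemma covered0 : covered 0 3.
Proof.
exists [:: (0, 3)]; split; rewrite ?big_seq1 //=; first by rewrite andbT; lra.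
by move=> [|//] z _; rewrite /in_cover /pos /= expr0 !divr1 orbF.
Qed.

Hypothesis t1 : `|t| <= 1.

Lemma pos_cat v x : `|pos (v ++ x) - pos v| <= 2 / 3 / 4 ^+ size v.
Proof.
rewrite /pos lam_cat size_cat exprD.
have v0 : 4 ^+ size v != 0 :> R by rewrite exp4_neq0.
have x0 : 4 ^+ size x != 0 :> R by rewrite exp4_neq0.
have -> : (4 ^+ size x * lam v + lam x) / (4 ^+ size v * 4 ^+ size x) - lam v / 4 ^+ size v
  = lam x / 4 ^+ size x / 4 ^+ size v.
  by field; rewrite v0 x0.
rewrite normrM [X in _ * X]ger0_norm ?invr_ge0 ?exprn_ge0 //.
apply: ler_wpM2r; first by rewrite invr_ge0 exprn_ge0.
rewrite normrM [X in _ * X]ger0_norm ?invr_ge0 ?exprn_ge0 //.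
rewrite ler_pdivrMr ?exprn_gt0 //.
by apply: le_trans (lam_bound t1 _) _; move: (4 ^+ _) => q; lra.
Qed.

Lemma coveredS n x : covered n x -> covered n.+1 x.
Proof.
move=> [s [s0 sx H]]; exists s; split => // w z wn zw.
have vn : size (take n w) = n by rewrite size_takel // wn.
apply: (H (take n w)) => //.
have := pos_cat (take n w) (drop n w); rewrite cat_take_drop vn => pw.
rewrite -(subrKA (pos w)); apply: le_trans (ler_normD _ _) _.
apply: le_trans (lerD zw pw) _.
rewrite exprS invfM; have : 0 <= (4 ^+ n)^-1 :> R by rewrite invr_ge0 exprn_ge0.
by move: (4 ^+ n)^-1 => a; lra.
Qed.

Lemma covered_mono n m x : (n <= m)%N -> covered n x -> covered m x.
Proof. by move=> /subnKC <-; elim: (m - n)%N => [|k IH]; rewrite ?addn0 // addnS => /IH /coveredS. Qed.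

Lemma pairwise_sum_le1 (T : eqType) (r : rel T) (Q : pred T) (D : seq T) :
  pairwise r D -> (forall a b, a \in D -> b \in D -> Q a -> Q b -> ~~ r a b) ->
  (\sum_(v <- D) Q v <= 1)%N.
Proof.
elim: D => [|a D IH]; first by rewrite big_nil.
rewrite pairwise_cons => /andP[/allP aD pD] H; rewrite big_cons.
have [Qa|_] := boolP (Q a); last first.
  by apply: IH => // x y xD yD; apply: H; rewrite inE ?xD ?yD orbT.
rewrite big_seq big1 // => b bD; apply/eqP; rewrite eqb0; apply/negP => Qb.
have := H a b (mem_head _ _); rewrite inE bD orbT => /(_ isT Qa Qb).
by rewrite aD.
Qed.

Section step.
Variables K n : nat.
Hypothesis K0 : (0 < K)%N.
Hypothesis n_min : forall m, (m < n)%N -> (npairs m <= 2 * K * 4 ^ m)%N.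
Hypothesis Tn : (2 * K * 4 ^ n < npairs n)%N.
Local Notation heavy := (heavy t K).
Local Notation bad := (bad t K).

Let hw := [seq v <- flatten [seq words l | l <- iota 1 n] | heavy v].

Lemma mem_hw v : (v \in hw) = heavy v && (0 < size v <= n)%N.
Proof.
rewrite mem_filter; congr (_ && _); apply/flattenP/idP => [[s /mapP[l]]|vn].
- by rewrite mem_iota add1n ltnS => ln -> ; rewrite mem_words => /eqP ->.
- by exists (words (size v)); rewrite ?mem_words // map_f // mem_iota add1n ltnS.
Qed.

(** The factor 2 exceeds the 5/3 of [desc_pos]: no word can be a [desc] of two words that are not
    near each other. *)
Let near (v u : seq digit) := `|pos v - pos u| <= 2 * (4 ^- size v + 4 ^- size u).

(** The words passing through the stack at [v]; for a heavy [v] they are more than [K] times as many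
    as the extensions of a single word of that length. *)
Let desc (v w : seq digit) := close (take (size v) w) v.

Lemma exp4V_gt0 k : 0 < 4 ^- k :> R.
Proof. by rewrite invr_gt0 exprn_gt0. Qed.

Lemma desc_pos v w : (size v <= size w)%N -> desc v w ->
  `|pos w - pos v| <= 5 / 3 / 4 ^+ size v.
Proof.
move=> vw; have sv : size (take (size v) w) = size v by rewrite size_takel.
rewrite /desc close_pos // sv => h.
have := pos_cat (take (size v) w) (drop (size v) w); rewrite cat_take_drop sv => h2.
rewrite -(subrKA (pos (take (size v) w))); apply: le_trans (ler_normD _ _) _.
apply: le_trans (lerD h2 h) _.
by have := exp4V_gt0 (size v); lra.
Qed.

Lemma sum_desc v : (size v <= n)%N ->
  (\sum_(w <- words n) desc v w = cnt v * 4 ^ (n - size v))%N.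
Proof.
move=> vn; rewrite -{1}(subnKC vn) big_words_cat big_distrl /=.
rewrite !big_seq; apply: eq_bigr => u; rewrite mem_words => /eqP uv.
rewrite -sum_words1 big_distrr; apply: eq_bigr => x _ /=.
by rewrite muln1 /desc -uv take_size_cat // close_sym.
Qed.

Lemma select_heavy : exists2 D : seq (seq digit),
  [/\ (forall v, v \in D -> heavy v && (0 < size v <= n)%N),
   (forall v, heavy v -> (0 < size v <= n)%N -> exists2 u, u \in D & near v u && (size u <= size v)%N) &
   forall w, size w = n -> (\sum_(v <- D) desc v w <= 1)%N] & True.
Proof.
have nearxx : reflexive near.
  move=> v; rewrite /near subrr normr0 mulr_ge0 // addr_ge0 //; exact/ltW/exp4V_gt0.
have [D [Ds pD H]] := vitali_select (@size digit) hw nearxx.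
exists D => //; split.
- by move=> v /Ds; rewrite mem_hw.
- by move=> v hv vn; apply: H; rewrite mem_hw hv.
- move=> w wn; apply: (pairwise_sum_le1 (r := fun a b => ~~ near a b)) => //.
  move=> a b /Ds; rewrite mem_hw => /and3P[_ _ an] /Ds; rewrite mem_hw => /and3P[_ _ bn].
  rewrite -wn in an bn.
  move=> /(desc_pos an) ha /(desc_pos bn) hb; rewrite negbK /near.
  rewrite -(subrKA (pos w)); apply: le_trans (ler_normD _ _) _.
  rewrite distrC; apply: le_trans (lerD ha hb) _.
  by have := exp4V_gt0 (size a); have := exp4V_gt0 (size b); lra.
Qed.

(** [mu] is the proportion of removed words. For a selected [v], one interval of radius
    [9 / 4 ^ size v] is paid for by at least [K * 4 ^ (n - size v)] removed words, and these
    families are disjoint; the total is at most [9 * mu / K]. Below each remaining word sits a copy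
    of the stage-[m] set scaled by [4 ^ - n], which gives [(1 - mu) * x]. *)
Lemma covered_step : exists2 mu : R, (24 * K%:R)^-1 <= mu <= 1 &
  forall m x, covered m x -> covered (n + m) (9 * mu / K%:R + (1 - mu) * x).
Proof.
have [D [Dh Dn D1] _] := select_heavy.
(* The bad words bound [mu] from below; the words through a selected stack pay for its interval. *)
pose rem w := bad [::] w || has (fun v => desc v w) D.
pose N := (\sum_(w <- words n) rem w)%N.
pose p : R := 4 ^+ n; have p0 : 0 < p by rewrite exprn_gt0.
have K0R : 0 < K%:R :> R by rewrite ltr0n.
have sumD : (\sum_(v <- D) K * 4 ^ (n - size v) <= N)%N.
  apply: leq_trans (_ : \sum_(v <- D) \sum_(w <- words n) desc v w <= _)%N.
    rewrite !big_seq; apply: leq_sum => v /Dh /andP[hv /andP[_ vn]].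
    by rewrite sum_desc // leq_mul2r; apply/orP; right; exact: ltnW hv.
  rewrite exchange_big /= /N !big_seq; apply: leq_sum => w.
  rewrite mem_words => /eqP wn.
  rewrite /rem; have [_|/hasPn h] := boolP (has _ D); first by rewrite orbT D1.
  by rewrite big_seq big1 // => v /h /negPf ->.
have NE (F : seq digit -> R) c : (forall w, ~~ rem w -> F w = c) ->
    (forall w, rem w -> F w = 0) -> \sum_(w <- words n) F w = (p - N%:R) * c.
  move=> F0 F1.
  have -> : p = \sum_(w <- words n) 1.
    by rewrite big_const_seq count_predT size_words iter_addr_0 /p natrX.
  rewrite /N natr_sum -sumrB mulr_suml; apply: eq_bigr => w _.
  have [rw|rw] := boolP (rem w); first by rewrite F1 //= subrr mul0r.
  by rewrite F0 //= subr0 mul1r.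
have Nle : N%:R <= p.
  rewrite /p -natrX ler_nat -sum_words1; apply: leq_sum => w _; exact: leq_b1.
have Nge : p <= 24 * K%:R * N%:R.
  rewrite /p -!natrM -natrX ler_nat ltnW //.
  apply: leq_trans (many_bad t1 n_min K0 Tn) _; rewrite leq_mul2l; apply/orP; right.
  by apply: leq_sum => w _; rewrite /rem; case: (bad _ _).
exists (N%:R / p).
  rewrite ler_pdivrMr // mul1r Nle andbT ler_pdivlMr // mulrC ler_pdivrMr ?mulr_gt0 //.
  by rewrite mulrC.
move=> m x [s [s0 sx Hs]].
pose sh : seq (R * R) := [seq (pos v, 9 / 4 ^+ size v) | v <- D].
pose sc w : seq (R * R) := [seq (pos w + i.1 / p, i.2 / p) | i <- s].
exists (sh ++ flatten [seq (if rem w then [::] else sc w) | w <- words n]); split.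
- rewrite all_cat; apply/andP; split.
    by apply/allP => I /mapP[v _ ->] /=; rewrite divr_ge0 ?exprn_ge0.
  apply/allP => I /flattenP[q /mapP[w _ ->]]; case: ifP => // _ /mapP[J Js ->] /=.
  by rewrite divr_ge0 ?(ltW p0) //; exact: (allP s0).
- rewrite big_cat big_flatten !big_map /=.
  rewrite (NE _ (\sum_(i <- s) i.2 / p)); last 2 first.
  + by move=> w /negPf ->; rewrite big_map.
  + by move=> w ->; rewrite big_nil.
  apply: lerD; last first.
    rewrite -mulr_suml; set S := \sum_(i <- s) _.
    have -> : (1 - N%:R / p) * x = (p - N%:R) * (x / p) by field; rewrite gt_eqF.
    apply: ler_wpM2l; first by rewrite subr_ge0.
    by apply: ler_wpM2r => //; rewrite invr_ge0 ltW.
  rewrite ler_pdivlMr // mulr_suml (_ : 9 * (N%:R / p) = 9 / p * N%:R); last by ring.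
  apply: le_trans (_ : 9 / p * (\sum_(v <- D) K * 4 ^ (n - size v))%:R <= _); last first.
    by rewrite ler_pM2l ?ler_nat // divr_gt0.
  rewrite natr_sum mulr_sumr !big_seq; apply: ler_sum => v /Dh /and3P[_ _ vn].
  rewrite natrM natrX.
  have v0 : 4 ^+ size v != 0 :> R by rewrite exp4_neq0.
  rewrite /p -{1}(subnK vn) exprD; set q := 4 ^+ (n - _).
  by apply: eq_ler; field; rewrite v0 ?exp4_neq0.
- move=> w z wnm zw.
  have wn : size (take n w) = n by rewrite size_takel // wnm leq_addr.
  have xm : size (drop n w) = m by rewrite size_drop wnm addKn.
  have pwz : `|z - pos (take n w)| <= 4 / p.
    have := pos_cat (take n w) (drop n w); rewrite cat_take_drop wn => h.
    rewrite -(subrKA (pos w)); apply: le_trans (ler_normD _ _) _.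
    apply: le_trans (lerD zw h) _; rewrite -/p exprD invfM -/p.
    have q0 : 0 < p^-1 by rewrite invr_gt0.
    have q1 : (4 ^+ m)^-1 <= 1 :> R by rewrite invf_le1 ?exprn_gt0 // exprn_ege1 // ler1n.
    move: q0 q1; move: (p^-1) (4 ^+ m)^-1 => a b a0 b1.
    have : a * b <= a by rewrite ler_piMr // ltW.
    lra.
  (* The radius is [9 = 4 + 5]: [z] is within [4 / p] of the prefix, and [1 / p <= 4 ^- size v]. *)
  have hcov v : v \in D -> `|pos (take n w) - pos v| <= 5 * 4 ^- size v -> in_cover sh z.
    move=> vD hv; apply/hasP; exists (pos v, 9 / 4 ^+ size v) => /=; first exact: map_f.
    rewrite -(subrKA (pos (take n w))); apply: le_trans (ler_normD _ _) _.
    apply: le_trans (lerD pwz hv) _.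
    have /and3P[_ _ vn] := Dh _ vD.
    have : p^-1 <= 4 ^- size v by rewrite lef_pV2 ?posrE ?exprn_gt0 // ler_weXn2l // ler1n.
    lra.
  rewrite /in_cover has_cat; apply/orP.
  have [rw|rw] := boolP (rem (take n w)).
  + left; move: rw => /orP[|/hasP[v vD dv]].
    * move=> /badP[l /andP[l0]]; rewrite wn => ln /= hl.
      have ls : size (take l (take n w)) = l by rewrite size_takel // wn.
      have [|u uD /andP[nu lu]] := Dn _ hl; first by rewrite ls l0.
      apply: (hcov u) => //.
      have := pos_cat (take l (take n w)) (drop l (take n w)); rewrite cat_take_drop ls => h.
      rewrite -(subrKA (pos (take l (take n w)))); apply: le_trans (ler_normD _ _) _.
      apply: le_trans (lerD h nu) _; rewrite ls in lu *.
      (* The selection by size is used here: since [u] is no longer than the heavy prefix, the error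
         [(2/3 + 2) * 4 ^- l + 2 * 4 ^- size u] is below [5 * 4 ^- size u]. *)
      have : 4 ^- l <= 4 ^- size u :> R by rewrite lef_pV2 ?posrE ?exprn_gt0 // ler_weXn2l // ler1n.
      by have := exp4V_gt0 l; lra.
    * have /and3P[_ _ vn] := Dh _ vD.
      apply: (hcov v) => //; apply: le_trans (desc_pos _ dv) _; rewrite ?wn //.
      by have := exp4V_gt0 (size v); lra.
  + right; apply/hasP.
    have := Hs (drop n w) ((z - pos (take n w)) * p) xm.
    have -> : (z - pos (take n w)) * p - pos (drop n w) = (z - pos w) * p.
      rewrite -{3}(cat_take_drop n w) /pos lam_cat size_cat wn xm exprD -/p.
      by field; rewrite ?exp4_neq0.
    rewrite normrM (ger0_norm (ltW p0)) => /(_ _)/hasP[].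
      move: zw; rewrite exprD -/p -ler_pdivlMr // => /le_trans; apply.
      by apply: eq_ler; field; rewrite ?exp4_neq0.
    move=> I Is hI; exists (pos (take n w) + I.1 / p, I.2 / p).
      apply/flattenP; exists (sc (take n w)); last exact: map_f.
      apply/mapP; exists (take n w); first by rewrite mem_words wn.
      by rewrite (negPf rw).
    rewrite /= ler_pdivlMr // -{2}(ger0_norm (ltW p0)) -normrM.
    apply: le_trans hI; apply: eq_ler; congr (`|_|).
    by field; rewrite exp4_neq0.
Qed.

End step.

End covers.

(** Bernoulli's inequality in inverse form. With [m * x = 1] it gives [(1 - x) ^ m <= 1 / 2]. *)
Lemma expr_1B_le (R : realFieldType) (x : R) m :
  0 <= x <= 1 -> (1 - x) ^+ m * (1 + m%:R * x) <= 1.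
Proof.
move=> /andP[x0 x1]; elim: m => [|m IH]; first by rewrite expr0 mul0r addr0 mulr1.
apply: le_trans IH; rewrite exprSr -mulrA; apply: ler_wpM2l.
  by rewrite exprn_ge0 // subr_ge0.
by rewrite -natr1; have : 0 <= m%:R :> R by []; nra.
Qed.

(** [9 / K] is the fixed point of the affine map in [covered_step]. The excess over it starts from
    at most 3 and is halved every [24 * K] steps, so [k] rounds reduce it to [3 / K]. *)
Lemma covered_of_npairs (R : realType) (t : R) (K k n N : nat) :
  `|t| <= 1 -> (0 < K)%N -> (K <= 2 ^ k)%N -> (n <= N)%N ->
  (2 * K * 4 ^ n < npairs t n)%N ->
  covered t (24 * K * k * N) (12 / K%:R).
Proof.
move=> t1 K0 Kk nN Tn.
have [n0 Tn0 n0_min] := ex_minnP (ex_intro _ n Tn : exists n, (2 * K * 4 ^ n < npairs t n)%N).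
have n0N : (n0 <= N)%N by apply: leq_trans nN; apply: n0_min.
have n_min m : (m < n0)%N -> (npairs t m <= 2 * K * 4 ^ m)%N.
  by move=> mn; rewrite leqNgt; apply/negP => /n0_min; rewrite leqNgt mn.
have [mu /andP[mu0 mu1] step] := covered_step t1 K0 n_min Tn0.
have K0R : 0 < K%:R :> R by rewrite ltr0n.
set b : R := (24 * K%:R)^-1 in mu0.
have b0 : 0 <= b by rewrite invr_ge0 mulr_ge0 // ltW.
have b1 : b <= 1 by exact: le_trans mu1.
pose X s : R := 9 / K%:R + 3 * (1 - b) ^+ s.
have cov s : covered t (s * n0) (X s).
  elim: s => [|s IH].
    rewrite mul0n; apply: covered_le (covered0 t).
    by rewrite /X expr0 mulr1 lerDr divr_ge0 // ltW.
  rewrite mulSn; apply: covered_le (step _ _ IH); rewrite /X exprS.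
  set c := K%:R^-1; rewrite (_ : 9 * mu / K%:R = 9 * c * mu); last by rewrite /c; ring.
  have : 0 <= (1 - b) ^+ s by rewrite exprn_ge0 // subr_ge0.
  by move: ((1 - b) ^+ s) => y y0; nra.
have half : (1 - b) ^+ (24 * K) <= 2^-1.
  have := @expr_1B_le _ b (24 * K); rewrite b0 b1 => /(_ isT).
  have -> : (24 * K)%:R * b = 1 by rewrite /b natrM mulfV // mulf_neq0 // ?gt_eqF.
  by move: (_ ^+ _) => y; lra.
apply: (@covered_mono _ _ t1 (24 * K * k * n0)%N).
  by rewrite leq_mul2l n0N orbT.
apply: covered_le (cov _); rewrite /X exprM.
have : (1 - b) ^+ (24 * K) ^+ k <= K%:R^-1.
  apply: (@le_trans _ _ (2^-1 ^+ k)).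
    by rewrite lerXn2r // ?nnegrE ?exprn_ge0 ?invr_ge0 // subr_ge0.
  by rewrite exprVn lef_pV2 ?posrE ?exprn_gt0 // -natrX ler_nat.
by move: (_ ^+ k) => y; lra.
Qed.

(** * Calculus: integrals of continuous functions through primitives *)

Section continuous_pointwise.
Variable R : realType.
Implicit Types f g : R -> R.

Lemma contD f g : continuous f -> continuous g -> continuous (fun x => f x + g x).
Proof. by move=> cf cg x; exact: (@continuousD _ _ _ f g x (cf x) (cg x)). Qed.

Lemma contM f g : continuous f -> continuous g -> continuous (fun x => f x * g x).
Proof. by move=> cf cg x; exact: (@continuousM _ _ f g x (cf x) (cg x)). Qed.

Lemma contZ c f : continuous f -> continuous (fun x => c * f x).
Proof. by move=> cf; apply: (@contM (cst c) f) => //; exact: cst_continuous. Qed.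

Lemma cont_comp f g : continuous f -> continuous g -> continuous (fun x => f (g x)).
Proof. by move=> cf cg x; apply: (@continuous_comp _ _ _ g f); [exact: cg|exact: cf]. Qed.

Lemma cont_affine (c d : R) : continuous (fun x : R => c * x + d).
Proof. by apply: contD; [apply: contZ => x; exact: cvg_id|exact: cst_continuous]. Qed.

Lemma cont_sum (T : Type) (s : seq T) (h : T -> R -> R) :
  (forall i, continuous (h i)) -> continuous (fun x => \sum_(i <- s) h i x).
Proof.
move=> ch; elim: s => [|i s IH].
  by under eq_fun do rewrite big_nil; exact: cst_continuous.
by under eq_fun do rewrite big_cons; exact: contD.
Qed.

Lemma cont_prod (T : Type) (s : seq T) (h : T -> R -> R) :
  (forall i, continuous (h i)) -> continuous (fun x => \prod_(i <- s) h i x).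
Proof.
move=> ch; elim: s => [|i s IH].
  by under eq_fun do rewrite big_nil; exact: cst_continuous.
by under eq_fun do rewrite big_cons; exact: contM.
Qed.

End continuous_pointwise.

Section primitive.
Variable R : realType.
Implicit Types (f g F G : R -> R) (a b c d x y : R).
Local Notation mu := (@lebesgue_measure R).

Lemma is_derive_continuous F x d : is_derive x 1 F d -> {for x, continuous F}.
Proof. by move=> h; apply/differentiable_continuous/derivable1_diffP. Qed.

Lemma is_derive_eq_oo F G f a x y : a < x -> a < y ->
  (forall z, a < z -> is_derive z 1 F (f z)) ->
  (forall z, a < z -> is_derive z 1 G (f z)) ->
  F y - F x = G y - G x.
Proof.
move=> + + hF hG; wlog xy : x y / x <= y.
  move=> H ax ay; have [xy|/ltW yx] := leP x y; first exact: H.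
  by have := H _ _ yx ay ax; lra.
move=> ax ay.
have hd z : a < z -> is_derive z 1 (F - G) 0.
  by move=> az; have h1 := hF z az; have h2 := hG z az; apply: is_derive_eq; rewrite subrr.
have [c _ H] : exists2 c, c \in `[x, y] & (F - G) y - (F - G) x = cst 0 c * (y - x).
  apply: MVT_segment => //.
  - by move=> z /[!in_itv] /= /andP[xz _]; apply: hd; apply: lt_trans xz.
  - apply: derivable_within_continuous => z /[!in_itv] /= /andP[xz _].
    by have [] := hd z (lt_le_trans ax xz).
by move: H; rewrite /= mul0r !fctE; lra.
Qed.

Lemma primitive_half f : continuous f -> forall a,
  exists F, forall x, a < x -> is_derive x 1 F (f x).
Proof.
move=> cf a; exists (fun x => (\int[mu]_(t in `[a, x]) (f t))%R) => x ax.
have fi : mu.-integrable `[a, x + 1] (EFin \o f).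
  apply: continuous_compact_integrable; first exact: segment_compact.
  exact: continuous_subspaceT.
have xx : x < x + 1 by rewrite ltrDl.
have [d1 d2] := continuous_FTC1_closed xx fi ax (cf x).
by apply: DeriveDef; [exact: d1|rewrite -derive1E; exact: d2].
Qed.

(** Primitives on the half-lines from [- n] are normalized to vanish at 0 and glued; [N x >= 1]
    keeps 0 inside each half-line. *)
Lemma exists_primitive f : continuous f ->
  exists F, forall x, is_derive x 1 F (f x).
Proof.
move=> cf.
have /choice[H HP] : forall n : nat, exists F,
  forall x, - n%:R < x -> is_derive x 1 F (f x).
  by move=> n; exact: primitive_half.
pose N x := (Num.truncn `|x|).+1.
have Nx x : `|x| < (N x)%:R by rewrite truncnS_gt.
have Nx' x : - (N x)%:R < x by have := Nx x; rewrite ltr_norml => /andP[].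
pose G n x := H n x - H n 0.
have dG n x : - n%:R < x -> is_derive x 1 (G n) (f x).
  by move=> nx; have h := HP _ _ nx; apply: is_derive_eq; rewrite subr0.
have GG n m x : (0 < n)%N -> (n <= m)%N -> - n%:R < x -> G n x = G m x.
  move=> n0 nm nx.
  have := @is_derive_eq_oo (G n) (G m) f (- n%:R) 0 x _ nx (dG n) _.
  rewrite /G; move=> h; have : (- n%:R < 0 :> R) by rewrite oppr_lt0 ltr0n.
  move=> /h{}h; suff : H n x - H n 0 - (H n 0 - H n 0) = H m x - H m 0 - (H m 0 - H m 0) by lra.
  apply: h => z nz; apply: dG; apply: le_lt_trans nz.
  by rewrite lerN2 ler_nat.
exists (fun x => G (N x) x) => x.
have Nx2 : - (N x).+1%:R < x.
  by apply: le_lt_trans (Nx' x); rewrite lerN2 ler_nat.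
apply: near_eq_is_derive (dG _ _ Nx2) => //.
near=> y.
have [yn|/ltnW yn] := leqP (N x).+1 (N y).
  by apply/GG => //; near: y; apply: lt_nbhsr.
by apply/esym/GG.
Unshelve. all: by end_near. Qed.

(** With a global primitive, integrals are additive for end points in any order, and affine
    substitutions reduce to the chain rule. [integral_Int] gives the link with the Lebesgue
    integral. *)
Definition prim f : R -> R := xget (cst 0) [set F | forall x, is_derive x 1 F (f x)].

Lemma is_derive_prim f : continuous f -> forall x, is_derive x 1 (prim f) (f x).
Proof. by move=> /exists_primitive[F FP] x; rewrite /prim; case: xgetP => [G _|/(_ F)]. Qed.

Definition Int f a b := prim f b - prim f a.

Lemma IntE f F a b : (forall x, is_derive x 1 F (f x)) -> Int f a b = F b - F a.
Proof.
move=> FP; rewrite /Int /prim; case: xgetP => [G _ GP|/(_ F)//].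
apply: (@is_derive_eq_oo _ _ f (Num.min a b - 1)) => //.
- by rewrite ltrBlDr ltr_pwDr // ge_min lexx.
- by rewrite ltrBlDr ltr_pwDr // ge_min lexx orbT.
Qed.

Lemma Int_cat f a b c : Int f a b + Int f b c = Int f a c.
Proof. by rewrite /Int; lra. Qed.

Lemma IntD f g a b : continuous f -> continuous g ->
  Int (fun x => f x + g x) a b = Int f a b + Int g a b.
Proof.
move=> cf cg.
have h x : is_derive x 1 (prim f + prim g) (f x + g x).
  by apply: is_deriveD; apply: is_derive_prim.
by rewrite (IntE _ _ h) /Int !fctE; lra.
Qed.

Lemma IntZ f c a b : continuous f -> Int (fun x => c * f x) a b = c * Int f a b.
Proof.
move=> cf.
have h x : is_derive x 1 (c *: prim f) (c * f x).
  by apply: is_deriveZ; apply: is_derive_prim.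
by rewrite (IntE _ _ h) /Int !fctE /GRing.scale /=; ring.
Qed.

Lemma Int_sum (T : Type) (s : seq T) (h : T -> R -> R) a b :
  (forall i, continuous (h i)) ->
  Int (fun x => \sum_(i <- s) h i x) a b = \sum_(i <- s) Int (h i) a b.
Proof.
move=> ch; elim: s => [|i s IH].
  rewrite big_nil (_ : (fun x => _) = fun x => 0 * 0 :> R).
    by rewrite IntZ ?mul0r // => x; exact: cst_continuous.
  by apply/funext => x; rewrite big_nil mul0r.
rewrite big_cons -IH -IntD //; last exact: cont_sum.
by congr Int; apply/funext => x; rewrite big_cons.
Qed.

Lemma Int_ge0 f a b : continuous f -> a <= b ->
  (forall x, a <= x <= b -> 0 <= f x) -> 0 <= Int f a b.
Proof.
move=> cf ab f0; have df := is_derive_prim cf.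
have [c cab H] : exists2 c, c \in `[a, b] & prim f b - prim f a = f c * (b - a).
  apply: MVT_segment => //.
  by apply: derivable_within_continuous => x _; have [] := df x.
rewrite /Int H; move: cab; rewrite in_itv /= => cab.
by rewrite mulr_ge0 ?subr_ge0 // f0.
Qed.

Lemma le_Int f g a b : continuous f -> continuous g -> a <= b ->
  (forall x, a <= x <= b -> f x <= g x) -> Int f a b <= Int g a b.
Proof.
move=> cf cg ab fg; rewrite -subr_ge0.
have -> : Int g a b - Int f a b = Int (fun x => g x + (-1) * f x) a b.
  rewrite IntD // ?IntZ //; first lra.
  exact: contZ.
apply: Int_ge0 => //.
  by apply: contD => //; exact: contZ.
by move=> x /fg; lra.
Qed.

Lemma Int_affine f c d a b : continuous f ->
  c * Int (fun x => f (c * x + d)) a b = Int f (c * a + d) (c * b + d).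
Proof.
move=> cf; rewrite -IntZ; last by apply: cont_comp => //; exact: cont_affine.
suff dF x : is_derive x 1 (fun x => prim f (c * x + d)) (c * f (c * x + d)).
  by rewrite (IntE _ _ dF).
have h := is_derive_prim cf (c * x + d).
have h2 : is_derive x 1 (fun x => c * x + d) c.
  by apply: is_derive_eq; rewrite addr0 /GRing.scale /= mulr1.
have := @is_derive1_comp R (prim f) (fun x => c * x + d) x _ _ h h2.
by rewrite mulrC.
Qed.

Lemma integral_Int f a b : continuous f -> a <= b ->
  (\int[mu]_(x in `[a, b]) (f x)%:E = (Int f a b)%:E)%E.
Proof.
move=> cf; rewrite le_eqVlt => /predU1P[<-|ab].
  by rewrite set_itv1 integral_set1 /Int subrr.
have df := is_derive_prim cf.
rewrite (@continuous_FTC2 _ f (prim f)) //.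
- exact: continuous_subspaceT.
- split.
  + by move=> x _; have [] := df x.
  + by apply: cvg_at_right_filter; apply: is_derive_continuous (df a).
  + by apply: cvg_at_left_filter; apply: is_derive_continuous (df b).
- by move=> x _; rewrite derive1E; have [] := df x.
Qed.

End primitive.

(** * Riesz products: pointwise bounds *)

Section riesz.
Variable R : realType.
Implicit Types (x y t : R).

Definition onecos x : R := 1 + cos x.

Definition riesz (n : nat) x : R := \prod_(j < n) onecos (4 ^+ j * x).

(* Equal to [sin (2 ^ m x / 2) ^ 2 / (4 ^ m sin (x / 2) ^ 2)]: with [m = 2 l], a continuous
   majorant (up to a constant) of the indicator of [|sin (x / 2)| <= 4 ^ - l]. *)
Definition dyadic (m : nat) x : R := \prod_(j < m) (onecos (2 ^+ j * x) / 2).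

Lemma onecos_ge0 x : 0 <= onecos x. Proof. by rewrite /onecos; have := cos_geN1 x; lra. Qed.
Lemma onecos_le2 x : onecos x <= 2. Proof. by rewrite /onecos; have := cos_le1 x; lra. Qed.

Lemma riesz_ge0 n x : 0 <= riesz n x. Proof. by apply: prodr_ge0 => j _; exact: onecos_ge0. Qed.
Lemma dyadic_ge0 m x : 0 <= dyadic m x.
Proof. by apply: prodr_ge0 => j _; rewrite divr_ge0 // onecos_ge0. Qed.

Lemma riesz_le n x : riesz n x <= 2 ^+ n.
Proof.
rewrite -[n in leRHS]card_ord -prodr_const; apply: ler_prod => j _.
by rewrite onecos_ge0 onecos_le2.
Qed.

Lemma rieszS n x : riesz n.+1 x = onecos x * riesz n (4 * x).
Proof.
rewrite /riesz big_ord_recl expr0 mul1r; congr (_ * _).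
by apply: eq_bigr => j _; rewrite lift0 exprSr mulrA.
Qed.

Lemma dyadicS m x : dyadic m.+1 x = onecos x / 2 * dyadic m (2 * x).
Proof.
rewrite /dyadic big_ord_recl expr0 mul1r; congr (_ * _).
by apply: eq_bigr => j _; rewrite lift0 exprSr mulrA.
Qed.

Lemma rieszD m n x : riesz (m + n) x = riesz m x * riesz n (4 ^+ m * x).
Proof.
elim: m x => [|m IH] x; first by rewrite /riesz big_ord0 expr0 !mul1r.
by rewrite addSn !rieszS IH exprSr !mulrA.
Qed.

Lemma continuous_onecos : continuous onecos.
Proof. by apply: contD; [exact: cst_continuous|exact: continuous_cos]. Qed.

Lemma continuous_riesz n : continuous (riesz n).
Proof.
apply: cont_prod => j; apply: cont_comp continuous_onecos _ => x.
by apply: (@contZ _ _ id) => {}x; exact: cvg_id.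
Qed.

Lemma continuous_dyadic m : continuous (dyadic m).
Proof.
apply: cont_prod => j; apply: contM; last exact: cst_continuous.
by apply: cont_comp continuous_onecos _; apply: (@contZ _ _ id) => x; exact: cvg_id.
Qed.

(* sin^2 (x / 2) *)
Definition sinhalf2 x : R := (1 - cos x) / 2.

Lemma sinhalf2_ge0 x : 0 <= sinhalf2 x. Proof. by rewrite /sinhalf2; have := cos_le1 x; lra. Qed.
Lemma sinhalf2_le1 x : sinhalf2 x <= 1. Proof. by rewrite /sinhalf2; have := cos_geN1 x; lra. Qed.
Lemma onecosE x : onecos x = 2 * (1 - sinhalf2 x). Proof. by rewrite /onecos /sinhalf2; lra. Qed.

Lemma sinhalf2_double x : sinhalf2 (2 * x) = 4 * sinhalf2 x * (1 - sinhalf2 x).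
Proof.
by rewrite /sinhalf2 (mulrC 2) -[2]/(2%:R) mulr_natr cos_mulr2n mulr2n; lra.
Qed.

(* The telescoping identity sin 4z = 4 sin z cos z cos 2z, with the factors
   cos 2z bounded by 1. *)
Lemma riesz_ge r x : sinhalf2 (4 ^+ r * x) <= 8 ^+ r * riesz r x * sinhalf2 x.
Proof.
elim: r x => [|r IH] x; first by rewrite expr0 !mul1r /riesz big_ord0 mul1r.
rewrite exprSr -mulrA; apply: le_trans (IH _) _.
have P0 : 0 <= 8 ^+ r * riesz r (4 * x) by rewrite mulr_ge0 ?exprn_ge0 ?riesz_ge0.
have key : sinhalf2 (4 * x) <= 8 * onecos x * sinhalf2 x.
  rewrite (_ : 4 * x = 2 * (2 * x)); last by ring.
  rewrite !sinhalf2_double onecosE; have := sinhalf2_ge0 x; have := sinhalf2_le1 x; have := sinhalf2_ge0 (2 * x).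
  rewrite sinhalf2_double; move: (sinhalf2 x) => s; nra.
apply: le_trans (ler_wpM2l P0 key) _; rewrite rieszS exprS; apply: eq_ler; ring.
Qed.

(** Factor [j] is [1 - sinhalf2 (2 ^+ j * x)], at least [1 - 4 ^ j * sinhalf2 x]; the constant is
    the sum [1 + 4 + ... + 4 ^ (m - 1)]. *)
Lemma dyadic_ge m x : 1 - (4 ^+ m - 1) / 3 * sinhalf2 x <= dyadic m x.
Proof.
elim: m x => [|m IH] x; first by rewrite /dyadic big_ord0 expr0; lra.
rewrite dyadicS onecosE; have := IH (2 * x); rewrite sinhalf2_double exprS.
have := sinhalf2_ge0 x; have := sinhalf2_le1 x.
have : 1 <= 4 ^+ m :> R by rewrite exprn_ege1 // ler1n.
move: (sinhalf2 x) (4 ^+ m) (dyadic m _) => s a b a1 s1 s0 hb.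
have e : 2 * (1 - s) / 2 = 1 - s by field.
rewrite e.
have : (1 - s) * (1 - (a - 1) / 3 * (4 * s * (1 - s))) <= (1 - s) * b.
  by apply: ler_wpM2l hb; rewrite subr_ge0.
apply: le_trans.
have : 0 <= (a - 1) / 3 * s * s * (1 - s) by rewrite !mulr_ge0 ?subr_ge0 ?invr_ge0.
have : 0 <= (a - 1) / 3 * s * s by rewrite !mulr_ge0 ?subr_ge0 ?invr_ge0.
by move=> ? ?; nra.
Qed.

(** The index is the largest [i <= J] with [a <= 16 ^- i]. The region where [a * b] is small is thus
    covered by [J + 1] boxes; their number is the source of the factor [J] in the final average. *)
Lemma one_le_alternative J (a b : R) : 0 <= a -> 0 <= b <= 1 -> a <= 1 ->
  16 ^- J.+1 <= a * b \/
  exists2 i, (i <= J)%N & (a <= 16 ^- i) && (b <= 16 ^- (J - i)).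
Proof.
move=> a0 /andP[b0 b1] a1.
have ex0 : exists i, (i <= J)%N && (a <= 16 ^- i) by exists 0%N; rewrite expr0 invr1.
have [i /andP[iJ ai] imax] := ex_maxnP ex0 (fun i (p : (i <= J)%N && _) => (andP p).1).
have [bi|bi] := lerP b (16 ^- (J - i)); first by right; exists i => //; rewrite ai.
left; have iJ' : (i < J)%N.
  rewrite ltn_neqAle iJ andbT; apply/eqP => iE.
  by move: bi; rewrite iE subnn expr0 invr1 ltNge b1.
have ai' : 16 ^- i.+1 <= a.
  rewrite leNgt; apply/negP => /ltW ai'; have := imax i.+1.
  by rewrite iJ' ai' => /(_ isT); rewrite ltnn.
have -> : 16 ^- J.+1 = 16 ^- i.+1 * 16 ^- (J - i) :> R.
  by rewrite -invfM -exprD addSn subnKC.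
by apply: ler_pM => //; rewrite ?invr_ge0 ?exprn_ge0 // ltW.
Qed.

(** Away from the zeros of the sines, [riesz_ge] applied to both factors makes the first term at
    least 1, with [64 = 8 * 8]. Near the zeros one product of the sum is at least
    [(2 / 3) ^ 2 >= 1 / 3]. *)
Lemma pointwise_le r J t y : 1 <= 64 ^+ r * 16 ^+ J.+1 * (riesz r y * riesz r (t * y)) +
  3 * \sum_(i < J.+1) dyadic i.*2 (4 ^+ r * y) * dyadic (J - i).*2 (t * (4 ^+ r * y)).
Proof.
set A := 4 ^+ r * y; set B := t * A.
have hh i : 0 <= dyadic i.*2 A * dyadic (J - i).*2 B by rewrite mulr_ge0 ?dyadic_ge0.
have := @one_le_alternative J (sinhalf2 A) (sinhalf2 B) (sinhalf2_ge0 _).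
rewrite sinhalf2_ge0 sinhalf2_le1 => /(_ isT (sinhalf2_le1 _)) [ab|[i iJ /andP[Ai Bi]]].
- have S0 : 0 <= \sum_(i < J.+1) dyadic i.*2 A * dyadic (J - i).*2 B by exact: sumr_ge0.
  suff : 1 <= 64 ^+ r * 16 ^+ J.+1 * (riesz r y * riesz r (t * y)) by lra.
  have QA : sinhalf2 A <= 8 ^+ r * riesz r y.
    apply: le_trans (riesz_ge _ _) _; rewrite ler_piMr ?sinhalf2_le1 //.
    by rewrite mulr_ge0 ?exprn_ge0 ?riesz_ge0.
  have QB : sinhalf2 B <= 8 ^+ r * riesz r (t * y).
    rewrite /B /A mulrCA; apply: le_trans (riesz_ge _ _) _; rewrite ler_piMr ?sinhalf2_le1 //.
    by rewrite mulr_ge0 ?exprn_ge0 ?riesz_ge0.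
  have := ler_pM (sinhalf2_ge0 _) (sinhalf2_ge0 _) QA QB.
  move=> /(le_trans ab); rewrite -(ler_pM2l (_ : 0 < 16 ^+ J.+1)) ?exprn_gt0 //.
  rewrite mulfV ?expf_neq0 ?pnatr_eq0 // => /le_trans; apply; apply: eq_ler.
  rewrite (_ : 64 = 8 * 8 :> R) ?exprMn; last by rewrite -natrM.
  by ring.
- have h23 j x : sinhalf2 x <= 16 ^- j -> 2 / 3 <= dyadic j.*2 x.
    move=> xj; apply: le_trans (dyadic_ge _ _).
    rewrite -mul2n exprM (_ : 4 ^+ 2 = 16 :> R); last by rewrite -natrX.
    have p0 : 0 < 16 ^+ j :> R by rewrite exprn_gt0.
    have : (16 ^+ j - 1) * sinhalf2 x <= 16 ^+ j * 16 ^- j.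
      apply: ler_pM => //; rewrite ?sinhalf2_ge0 ?subr_ge0 ?exprn_ege1 ?ler1n //.
      by rewrite gerBl.
    by rewrite mulfV ?gt_eqF //; lra.
  have : 0 <= 64 ^+ r * 16 ^+ J.+1 * (riesz r y * riesz r (t * y)).
    by rewrite !mulr_ge0 ?exprn_ge0 ?riesz_ge0.
  have iJ' : (i < J.+1)%N by [].
  rewrite (bigD1 (Ordinal iJ')) //=.
  have S0 : 0 <= \sum_(k < J.+1 | k != Ordinal iJ') dyadic k.*2 A * dyadic (J - k).*2 B by exact: sumr_ge0.
  have := h23 _ _ Ai; have := h23 _ _ Bi.
  move: (dyadic i.*2 A) (dyadic (J - i).*2 B) S0 => a b S0 hb ha P0.
  have : 2 / 3 * (2 / 3) <= a * b by apply: ler_pM.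
  by lra.
Qed.

Lemma cos_ge x : 1 - x ^+ 2 / 2 <= cos x.
Proof.
wlog x0 : x / 0 <= x.
  move=> H; have [/H //|/ltW x0] := leP 0 x.
  by rewrite -(cosN x) -sqrrN; apply: H; rewrite oppr_ge0.
have sin_le y : 0 <= y -> sin y <= y.
  move=> y0; rewrite -subr_ge0.
  have d1 (z : R) : is_derive z 1 (fun x : R => x - sin x) (1 - cos z).
    by apply: is_derive_eq; rewrite /GRing.scale /=.
  have -> : y - sin y = Int (fun z => 1 - cos z) 0 y.
    by rewrite (IntE _ _ d1) sin0 !subr0.
  apply: Int_ge0 => //.
    by apply: contD; [exact: cst_continuous|move=> z; apply: continuousN; exact: continuous_cos].
rewrite -subr_ge0.
have d2 (z : R) : is_derive z 1 (fun x : R => cos x + x ^+ 2 / 2) (z - sin z).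
  by apply: is_derive_eq; rewrite /GRing.scale /= mulr1 !mulr0; lra.
have -> : cos x - (1 - x ^+ 2 / 2) = Int (fun z => z - sin z) 0 x.
  by rewrite (IntE _ _ d2) cos0 expr0n /= mul0r; lra.
apply: Int_ge0 => //.
  apply: contD; first by move=> z; exact: cvg_id.
  by move=> z; apply: continuousN; exact: continuous_sin.
by move=> z /andP[z0 _]; rewrite subr_ge0 sin_le.
Qed.

(** Each normalized factor is at least [1 - 16 ^- j / 4] for [j = 1, ..., m], and these losses add
    up to [(1 - 16 ^- m) / 60]. *)
Lemma riesz_small_ge m z : `|z| <= 1 ->
  1 - (1 - 16 ^- m) / 60 <= riesz m (z / 4 ^+ m) / 2 ^+ m.
Proof.
move=> z1; elim: m => [|m IH].
  by rewrite !expr0 invr1 subrr mul0r subr0 /riesz big_ord0 mulr1.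
rewrite rieszS (_ : 4 * _ = z / 4 ^+ m); last by rewrite exprS; field; rewrite exp4_neq0.
set x := z / 4 ^+ m.+1.
have x2 : x ^+ 2 <= 16 ^- m.+1.
  rewrite /x expr_div_n -exprM mulnC exprM (_ : 4 ^+ 2 = 16 :> R); last by rewrite -natrX.
  rewrite ler_piMl ?invr_ge0 ?exprn_ge0 //.
  by rewrite -(real_normK (num_real z)) expr_le1.
have e : 16 ^- m = 16 * 16 ^- m.+1 :> R.
  by rewrite exprS invfM mulrA mulfV ?mul1r // pnatr_eq0.
have := cos_ge x; rewrite /onecos [2 ^+ m.+1]exprS invfM; rewrite e in IH.
have s0 : 0 < 16 ^- m.+1 :> R by rewrite invr_gt0 exprn_gt0.
have s1 : 16 * 16 ^- m.+1 <= 1 :> R by rewrite -e invf_le1 ?exprn_gt0 // exprn_ege1 // ler1n.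
rewrite (_ : (1 + cos x) * riesz m (z / 4 ^+ m) * (2^-1 * 2 ^- m) =
  (1 + cos x) / 2 * (riesz m (z / 4 ^+ m) / 2 ^+ m)); last by ring.
move: (riesz _ _ / _) (16 ^- m.+1) x2 IH s0 s1 => P s x2 IH s0 s1 cx.
have : (1 - s / 4) * (1 - (1 - 16 * s) / 60) <= (1 + cos x) / 2 * P.
  by apply: ler_pM => //; lra.
by apply: le_trans; nra.
Qed.

Lemma riesz_small_ge_half m z t : `|z| <= 1 -> `|t| <= 1 ->
  1 / 2 <= riesz m (z / 4 ^+ m) * riesz m (t * (z / 4 ^+ m)) / 4 ^+ m.
Proof.
move=> z1 t1.
have tz1 : `|t * z| <= 1 by rewrite normrM mulr_ile1.
have := riesz_small_ge m z1; have := riesz_small_ge m tz1.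
rewrite (_ : 4 = 2 * 2 :> R) ?exprMn; last by rewrite -natrM.
rewrite -exprMn (_ : 2 * 2 = 4 :> R); last by rewrite -natrM.
rewrite mulrA (_ : 4 ^+ m = 2 ^+ m * 2 ^+ m); last by rewrite -exprMn -natrM.
set a := riesz m _; set b := riesz m _.
have s0 : 0 < 16 ^- m :> R by rewrite invr_gt0 exprn_gt0.
have -> : b * a / (2 ^+ m * 2 ^+ m) = a / 2 ^+ m * (b / 2 ^+ m) by rewrite invfM; ring.
move=> ha hb.
have : 59 / 60 * (59 / 60) <= a / 2 ^+ m * (b / 2 ^+ m) by apply: ler_pM => //; lra.
by lra.
Qed.

End riesz.

(** * Fejer kernels, and energies against pair counts *)

Section fejer.
Variable R : realType.
Implicit Types (x y xi a t : R).

(** The cosine transform of a tent. Unlike that of a sharp cutoff it is nonnegative, and it decays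
    like [xi ^ - 2], hence is summable over unit cells. *)
Definition fejer a xi := Int (fun y => (1 - y / a) * cos (xi * y)) 0 a.

Lemma continuous_lin (c : R) : continuous (fun y : R => c * y).
Proof. by apply: (@contZ _ _ id) => x; exact: cvg_id. Qed.

Lemma continuous_cosM (c : R) : continuous (fun y : R => cos (c * y)).
Proof. by apply: cont_comp; [exact: continuous_cos|exact: continuous_lin]. Qed.

Lemma continuous_tent a : continuous (fun y : R => 1 - y / a).
Proof.
rewrite (_ : (fun y => _) = fun y => - a^-1 * y + 1); first exact: cont_affine.
by apply/funext => y; ring.
Qed.

Lemma fejer0 a : a != 0 -> fejer a 0 = a / 2.
Proof.
move=> a0; rewrite /fejer.
have d (z : R) : is_derive z 1 (fun y : R => y - (2 * a)^-1 * y ^+ 2) ((1 - z / a) * cos (0 * z)).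
  rewrite mul0r cos0; apply: is_derive_eq; rewrite /GRing.scale /=.
  by field.
by rewrite (IntE _ _ d) expr0n /= mulr0; field.
Qed.

Lemma fejerE a xi : a != 0 -> xi != 0 ->
  fejer a xi = (1 - cos (a * xi)) / (a * xi ^+ 2).
Proof.
move=> a0 xi0; rewrite /fejer.
have ds (z : R) : is_derive z 1 (fun y : R => sin (xi * y)) (xi * cos (xi * z)).
  have h1 : is_derive z 1 (fun y : R => xi * y) xi.
    by apply: is_derive_eq; rewrite /GRing.scale /= mulr1.
  by have := is_derive1_comp (is_derive_sin (xi * z)) h1; rewrite mulrC.
have dc (z : R) : is_derive z 1 (fun y : R => cos (xi * y)) (- (xi * sin (xi * z))).
  have h1 : is_derive z 1 (fun y : R => xi * y) xi.
    by apply: is_derive_eq; rewrite /GRing.scale /= mulr1.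
  by have := is_derive1_comp (is_derive_cos (xi * z)) h1; rewrite mulrC mulrN.
have d (z : R) : is_derive z 1
    (fun y : R => (1 - y / a) * (xi^-1 * sin (xi * y)) - (a * xi ^+ 2)^-1 * cos (xi * y))
    ((1 - z / a) * cos (xi * z)).
  have := ds z; have := dc z => dcz dsz.
  apply: is_derive_eq; rewrite /GRing.scale /=.
  by field; rewrite a0.
rewrite (IntE _ _ d) mulr0 sin0 cos0 mulfV // subrr (mulrC a xi) mul0r !mulr0 mulr1.
by field; rewrite a0 xi0.
Qed.

Lemma fejer_ge0 a xi : 0 < a -> 0 <= fejer a xi.
Proof.
move=> a0; have an0 : a != 0 by rewrite gt_eqF.
have [->|xi0] := eqVneq xi 0; first by rewrite fejer0 // divr_ge0 // ltW.
rewrite fejerE // divr_ge0 ?subr_ge0 ?cos_le1 // mulr_ge0 ?sqr_ge0 //; exact: ltW.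
Qed.

Lemma fejer_le a xi : 0 < a -> fejer a xi <= a / 2.
Proof.
move=> a0; have an0 : a != 0 by rewrite gt_eqF.
rewrite -fejer0 //; apply: le_Int; last 2 first.
- exact: ltW.
- move=> x /andP[x0 xa]; rewrite mul0r cos0; apply: ler_wpM2l; last exact: cos_le1.
  by rewrite subr_ge0 ler_pdivrMr // mul1r.
- by apply: contM; [exact: continuous_tent|exact: continuous_cosM].
- by apply: contM; [exact: continuous_tent|exact: continuous_cosM].
Qed.

Lemma fejer_decay a xi : 0 < a -> xi != 0 -> fejer a xi <= 2 / (a * xi ^+ 2).
Proof.
move=> a0 xi0; rewrite fejerE ?(gt_eqF a0) //. apply: ler_wpM2r.
  by rewrite invr_ge0 mulr_ge0 ?sqr_ge0 // ltW.
by have := cos_geN1 (a * xi); lra.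
Qed.

Lemma cos_pair (z u : R) : \sum_(b : bool) \sum_(b' : bool) cos (z + u * (b%:R - b'%:R))
  = 2 * onecos u * cos z.
Proof.
rewrite !big_bool /= !subrr mulr0 addr0 subr0 sub0r mulr1 mulrN1 cosD cosB /onecos.
ring.
Qed.

Lemma cos_digits (t z s : R) :
  \sum_(d : digit) \sum_(d' : digit) cos (z + s * (dval t d - dval t d')) =
  4 * (onecos s * onecos (t * s)) * cos z.
Proof.
pose C (a a' b b' : bool) := cos (z + s * (a%:R - a'%:R) + t * s * (b%:R - b'%:R)).
have E (a b a' b' : bool) : cos (z + s * (dval t (a, b) - dval t (a', b'))) = C a a' b b'.
  by rewrite /C /dval /=; congr cos; ring.
have P (a a' : bool) := cos_pair (z + s * (a%:R - a'%:R)) (t * s).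
have P0 := cos_pair z s; rewrite !big_bool /= in P0.
rewrite !sum_digit !E.
have -> : 4 * (onecos s * onecos (t * s)) * cos z = 2 * onecos (t * s) * (2 * onecos s * cos z) by ring.
rewrite -P0.
have := P true true; have := P true false; have := P false true; have := P false false.
by rewrite /C !big_bool /=; move: (2 * onecos (t * s)) => W; lra.
Qed.

End fejer.

Lemma uniq_words n : uniq (words n).
Proof.
elim: n => //= n IH; apply: allpairs_uniq; rewrite ?enum_uniq //.
by move=> [a b] [c d] _ _ [-> ->].
Qed.

Section energies.
Variables (R : realType) (t : R).
Implicit Types (x y a p : R).
Local Notation lam := (lam t).

(** The squared modulus of the exponential sum in real form. The phase [x] carries the induction:
    the leading digits enter only through [4 ^ n * y * (dval d - dval d')], which is added to it. *)
Lemma sum_cos n x y :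
  \sum_(w <- words n) \sum_(w' <- words n) cos (x + y * (lam w - lam w')) =
  4 ^+ n * (riesz n y * riesz n (t * y)) * cos x.
Proof.
elim: n x => [|n IH] x.
  by rewrite !big_words0 /= /riesz !big_ord0 expr0 subrr mulr0 addr0 !mul1r.
rewrite big_wordsS; under eq_bigr do under eq_bigr do rewrite big_wordsS.
rewrite [LHS](_ : _ = \sum_(d : digit) \sum_(d' : digit)
    \sum_(w <- words n) \sum_(w' <- words n)
    cos ((x + 4 ^+ n * y * (dval t d - dval t d')) + y * (lam w - lam w'))).
  under eq_bigr do under eq_bigr do rewrite IH.
  under eq_bigr do rewrite -mulr_sumr; rewrite -mulr_sumr cos_digits.
  by rewrite /riesz !big_ord_recr /= exprS (mulrCA t); ring.
apply: eq_bigr => d _; rewrite exchange_big; apply: eq_bigr => d' _ /=.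
rewrite !big_seq; apply: eq_bigr => w; rewrite mem_words => /eqP wn.
rewrite !big_seq; apply: eq_bigr => w'; rewrite mem_words => /eqP wn'.
by rewrite wn wn'; congr cos; ring.
Qed.

Definition riesz2 n y := riesz n y * riesz n (t * y).

Lemma riesz2_ge0 n y : 0 <= riesz2 n y. Proof. by rewrite mulr_ge0 ?riesz_ge0. Qed.

Lemma continuous_riesz2 n : continuous (riesz2 n).
Proof.
apply: contM; first exact: continuous_riesz.
by apply: cont_comp; [exact: continuous_riesz|exact: continuous_lin].
Qed.

Lemma riesz2D m n y : riesz2 (m + n) y = riesz2 m y * riesz2 n (4 ^+ m * y).
Proof. by rewrite /riesz2 !rieszD (mulrCA t); ring. Qed.

Lemma continuous_riesz2M n p : continuous (fun y => riesz2 n (p * y)).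
Proof. by apply: cont_comp; [exact: continuous_riesz2|exact: continuous_lin]. Qed.

(* Positivity of the Fejer coefficients gives the lower bound below by keeping only the
   diagonal pairs; their decay gives the upper bound by the number of close pairs. *)
Lemma tent_riesz2 a p n : Int (fun y => (1 - y / a) * riesz2 n (p * y)) 0 a =
  4 ^- n * \sum_(w <- words n) \sum_(w' <- words n) fejer a (p * (lam w - lam w')).
Proof.
rewrite (_ : (fun y => _) = fun y => 4 ^- n * \sum_(w <- words n) \sum_(w' <- words n)
  (1 - y / a) * cos (p * (lam w - lam w') * y)).
  have c w w' : continuous (fun y => (1 - y / a) * cos (p * (lam w - lam w') * y)).
    by apply: contM; [exact: continuous_tent|exact: continuous_cosM].
  rewrite IntZ; last by apply: cont_sum => w; apply: cont_sum => w'.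
  rewrite Int_sum; last by move=> w; apply: cont_sum => w'.
  by congr (_ * _); apply: eq_bigr => w _; rewrite Int_sum.
apply/funext => y; under eq_bigr do rewrite -mulr_sumr; rewrite -mulr_sumr.
have := sum_cos n 0 (p * y); rewrite cos0 mulr1 => H.
rewrite [X in _ = 4 ^- n * (_ * X)](_ : _ = 4 ^+ n * riesz2 n (p * y)).
  by rewrite [RHS]mulrCA mulKf ?exp4_neq0.
rewrite -H; apply: eq_bigr => w _; apply: eq_bigr => w' _.
by congr cos; ring.
Qed.

Lemma Int_riesz2_ge p n : 1 / 2 <= Int (fun y => riesz2 n (p * y)) 0 1.
Proof.
apply: le_trans (_ : Int (fun y => (1 - y / 1) * riesz2 n (p * y)) 0 1 <= _); last first.
  apply: le_Int => //.
  - by apply: contM; [exact: continuous_tent|exact: continuous_riesz2M].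
  - exact: continuous_riesz2M.
  - move=> y /andP[y0 _]; rewrite ler_piMl ?riesz2_ge0 //; lra.
rewrite tent_riesz2 ler_pdivlMl ?exprn_gt0 //.
rewrite (_ : _ * _ = \sum_(w <- words n) (1 / 2 : R)); last first.
  by rewrite big_const_seq count_predT size_words iter_addr_0 -[RHS]mulr_natl natrX.
rewrite !big_seq; apply: ler_sum => w wn.
rewrite (bigD1_seq w) ?uniq_words //=.
rewrite subrr mulr0 fejer0 ?oner_eq0 // lerDl sumr_ge0 // => w' _.
exact: fejer_ge0.
Qed.

Definition energy n := Int (riesz2 n) 0 1.

Let fdist (u v : seq digit) : nat := `|Num.floor (lam u) - Num.floor (lam v)|%N.

(** Points whose floors differ by [m] are more than [m - 1] apart, and [fejer 2 xi] is at most both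
    1 and [xi ^ - 2]. *)
Let c (m : nat) : R := (maxn 1 m.-1)%:R ^- 2.

Lemma fejer_fdist_le u v : fejer 2 (lam u - lam v) <= c (fdist u v).
Proof.
rewrite /fdist; move: (lam u) (lam v) => x y.
have /andP[a1 a2] := floor_itv x; have /andP[b1 b2] := floor_itv y.
set k := Num.floor x - Num.floor y.
have hk : `|k%:~R - (x - y)| < 1.
  rewrite /k intrB ltr_norml; move: a1 a2 b1 b2; rewrite !intrD => *.
  by apply/andP; split; lra.
have kE : `|k%:~R| = `|k|%N%:R :> R by rewrite -intr_norm natr_absz.
have [k1|k1] := leqP `|k|%N 2.
  rewrite /c (_ : maxn _ _ = 1%N); last by lia.
  by rewrite expr1n invr1; apply: le_trans (fejer_le _ _) _; rewrite ?divff ?pnatr_eq0.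
have hD : (maxn 1 `|k|%N.-1)%:R < `|x - y|.
  rewrite (_ : maxn _ _ = `|k|%N.-1); last by lia.
  have : `|k%:~R| <= `|k%:~R - (x - y)| + `|x - y| :> R.
    by apply: le_trans (ler_normD _ _); rewrite subrK.
  rewrite kE -[in X in X <= _](prednK (ltnW (ltnW k1))) -natr1; lra.
have D0 : x - y != 0 by rewrite -normr_gt0; apply: le_lt_trans hD.
apply: le_trans (fejer_decay _ D0) _ => //.
have p1 : 0 < (maxn 1 `|k|%N.-1)%:R ^+ 2 :> R by rewrite exprn_gt0 // ltr0n leq_max.
have p2 : 0 < (x - y) ^+ 2 by rewrite exprn_even_gt0.
rewrite invfM mulrA divff ?pnatr_eq0 // mul1r /c lef_pV2 ?posrE //.
by rewrite -[leRHS]real_normK ?num_real // lerXn2r ?nnegrE // ltW.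
Qed.

Lemma sum_c B : \sum_(m < B) c m <= 4.
Proof.
have c0 m : 0 <= c m by rewrite invr_ge0 exprn_ge0.
have c1 m : (m <= 2)%N -> c m = 1.
  by move=> m2; rewrite /c (_ : maxn _ _ = 1%N) ?expr1n ?invr1 //; lia.
(* The terms 0, 1 and 2 equal 1; the tail [1/4 + 1/9 + ...] is below 1 by telescoping. *)
have H : \sum_(m < B.+3) c m <= 4 - B.+1%:R^-1.
  elim: B => [|B IH]; first by rewrite !big_ord_recr big_ord0 /= !c1 // invr1; lra.
  rewrite big_ord_recr /=; apply: le_trans (lerD IH (lexx _)) _.
  rewrite /c (maxn_idPr _) //=.
  have b0 : 0 < B.+1%:R :> R by [].
  rewrite -[B.+2%:R]natr1; move: (B.+1%:R) b0 => b b0.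
  have -> : 4 - b^-1 + (b + 1) ^- 2 = 4 - (b + 1)^-1 - (b * (b + 1) ^+ 2)^-1.
    by field; rewrite !gt_eqF // addr_gt0.
  by rewrite gerBl invr_ge0 mulr_ge0 ?sqr_ge0 // ltW.
apply: (@le_trans _ _ (\sum_(m < B.+3) c m)).
  rewrite !big_ord_recr /=.
  by have := c0 B; have := c0 B.+1; have := c0 B.+2; lra.
by apply: le_trans H _; rewrite gerBl invr_ge0.
Qed.

Lemma count_fdist_le n (m : nat) :
  (\sum_(w <- words n) \sum_(w' <- words n) (fdist w w' == m) <= 2 * npairs t n)%N.
Proof.
have H (k : int) := floor_shift_pairs_le t n 0 k%:~R.
apply: leq_trans (_ : _ <= \sum_(w <- words n) \sum_(w' <- words n)
  ((Num.floor (lam w + 0) == Num.floor (lam w' + m%:~R)) +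
   (Num.floor (lam w + 0) == Num.floor (lam w' + (- m%:Z)%:~R))))%N _; last first.
  under eq_bigr do rewrite big_split; rewrite big_split /=.
  by rewrite mul2n -addnn leq_add // H.
apply: leq_sum => w _; apply: leq_sum => w' _.
have fl x (k : int) : Num.floor (x + k%:~R) = Num.floor x + k :> int.
  by rewrite floorDrz ?intr_int // intrKfloor.
rewrite addr0 !fl /fdist; move: (Num.floor (lam w)) (Num.floor (lam w')) => a b.
case: eqP => //= e; have [h|h] : a = b + m%:Z \/ a = b - m%:Z by lia.
  by rewrite h eqxx.
by rewrite h eqxx addn1.
Qed.

Lemma sum_fejer_le n :
  \sum_(w <- words n) \sum_(w' <- words n) fejer 2 (lam w - lam w') <=
  8 * (npairs t n)%:R.
Proof.
pose B := (\max_(w <- words n) \max_(w' <- words n) fdist w w').+1.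
have fB w w' : w \in words n -> w' \in words n -> (fdist w w' < B)%N.
  move=> wn wn'; rewrite ltnS /B.
  apply: leq_trans (leq_bigmax_seq _ wn isT).
  exact: (leq_bigmax_seq _ wn' isT).
apply: (@le_trans _ _ (\sum_(w <- words n) \sum_(w' <- words n)
   \sum_(m < B) c m * (fdist w w' == m)%:R)).
  rewrite !big_seq; apply: ler_sum => w wn; rewrite !big_seq; apply: ler_sum => w' wn'.
  apply: le_trans (fejer_fdist_le _ _) _.
  rewrite (bigD1 (Ordinal (fB _ _ wn wn'))) //= eqxx mulr1 lerDl sumr_ge0 // => m _.
  by rewrite mulr_ge0 // invr_ge0 exprn_ge0.
under eq_bigr do rewrite exchange_big; rewrite exchange_big /=.
apply: (@le_trans _ _ (\sum_(m < B) c m * (2 * npairs t n)%:R)).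
  apply: ler_sum => m _; under eq_bigr do rewrite -mulr_sumr; rewrite -mulr_sumr.
  apply: ler_wpM2l; first by rewrite invr_ge0 exprn_ge0.
  under eq_bigr do rewrite -natr_sum; rewrite -natr_sum ler_nat; exact: count_fdist_le.
rewrite -mulr_suml; have := sum_c B; rewrite natrM.
have : 0 <= (npairs t n)%:R :> R by [].
by nra.
Qed.

(** The weight [2 * (1 - y / 2)] is at least 1 on [[0, 1]] and nonnegative up to 2; then
    [16 = 2 * 8] by [sum_fejer_le]. *)
Lemma energy_le n : energy n <= 16 * (npairs t n)%:R / 4 ^+ n.
Proof.
have c0 : continuous (fun y => (1 - y / 2) * riesz2 n y).
  by apply: contM; [exact: continuous_tent|exact: continuous_riesz2].
have c1 : continuous (fun y => 2 * ((1 - y / 2) * riesz2 n y)) by apply: contZ.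
apply: (@le_trans _ _ (Int (fun y => 2 * ((1 - y / 2) * riesz2 n y)) 0 1)).
  apply: le_Int => //; first exact: continuous_riesz2.
  by move=> y /andP[y0 y1]; rewrite mulrA ler_peMl ?riesz2_ge0 //; lra.
apply: (@le_trans _ _ (Int (fun y => 2 * ((1 - y / 2) * riesz2 n y)) 0 2)).
  rewrite -(Int_cat _ 0 1 2) lerDl; apply: Int_ge0 => //; first by rewrite ler1n.
  by move=> y /andP[y0 y1]; rewrite mulr_ge0 // mulr_ge0 ?riesz2_ge0 //; lra.
rewrite IntZ //; have := tent_riesz2 2 1 n.
under eq_fun do rewrite mul1r; move=> ->.
under eq_bigr do under eq_bigr do rewrite mul1r.
rewrite mulrA mulrC ler_pdivlMr ?exprn_gt0 //.
have := sum_fejer_le n; set S := \sum_(w <- _) _ => S8.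
by rewrite (_ : _ * _ * _ = 2 * S); [lra|field; rewrite exp4_neq0].
Qed.

End energies.

(** * Frequency blocks and the low/high frequency dichotomy *)

Section blocks.
Variables (R : realType) (t : R).
Implicit Types (x y a p : R).
Local Notation riesz2 := (riesz2 t).
Local Notation energy := (energy t).

Lemma exp4V_le1 n : 4 ^- n <= 1 :> R.
Proof. by rewrite invf_le1 ?exprn_gt0 // exprn_ege1 // ler1n. Qed.

(** The mass on [[0, 1]] is at least [1 / 2] at every scale, and after rescaling the part below
    [4 ^- r] is [4 ^- r] times the energy, at most [1 / 4]. *)
Lemma block_mass r L (K : R) : energy L <= 32 * K -> 128 * K <= 4 ^+ r ->
  1 / 4 <= Int (fun y => riesz2 L (4 ^+ r * y)) (4 ^- r) 1.
Proof.
move=> GL Kr; have := Int_riesz2_ge t (4 ^+ r) L.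
rewrite -(Int_cat _ 0 (4 ^- r) 1).
have := Int_affine (4 ^+ r) 0 0 (4 ^- r) (@continuous_riesz2 R t L).
rewrite !addr0 mulr0 mulfV ?exp4_neq0 //.
under eq_fun do rewrite addr0.
set I1 := Int _ 0 _; set I2 := Int _ _ 1; rewrite -/(energy L) => e.
have p0 : 0 < 4 ^+ r :> R by rewrite exprn_gt0.
have : 4 ^+ r * I1 <= 4 ^+ r / 4 by rewrite e; lra.
by rewrite ler_pM2l //; lra.
Qed.

Hypothesis t1 : `|t| <= 1.

(* The extra factors of frequency below 1 stay away from 0 on [[-1, 1]]. *)
Lemma block_energy_le r n m :
  Int (riesz2 n) (4 ^- r) 1 <= 2 * Int (riesz2 (m + n)) (4 ^- m * 4 ^- r) (4 ^- m).
Proof.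
have cf := @continuous_riesz2 R t (m + n).
have := Int_affine (4 ^- m) 0 (4 ^- r) 1 cf; rewrite !addr0 mulr1 => <-.
under eq_fun do rewrite addr0.
rewrite mulrA -IntZ; last exact: continuous_riesz2M.
apply: le_Int; first exact: continuous_riesz2.
- by apply: contZ; exact: continuous_riesz2M.
- exact: exp4V_le1.
- move=> y /andP[y0 y1].
  have yn : `|y| <= 1.
    by rewrite ger0_norm //; apply: le_trans y0; rewrite invr_ge0 exprn_ge0.
  have := riesz_small_ge_half m yn t1.
  rewrite (mulrC y) -/(riesz2 m (4 ^- m * y)) => H.
  rewrite riesz2D mulVKf ?exp4_neq0 //.
  rewrite (_ : _ * (_ * _) = 2 * (riesz2 m (4 ^- m * y) / 4 ^+ m) * riesz2 n y); last by ring.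
  by rewrite ler_peMl ?riesz2_ge0 //; lra.
Qed.

(** The rescaled blocks are consecutive intervals inside [[0, 1]] for the single integrand
    [riesz2 N], so all [M] block energies together cost one energy, up to the factor 2. *)
Lemma sum_block_energy_le r M N : (M * r <= N)%N ->
  \sum_(i < M) Int (riesz2 (i.+1 * r)) (4 ^- r) 1 <= 2 * energy N.
Proof.
move=> MN.
pose e i : R := 4 ^+ (i * r) / 4 ^+ N.
have tel : \sum_(i < M) Int (riesz2 N) (e i) (e i.+1) = Int (riesz2 N) (e 0) (e M).
  elim: M {MN} => [|M IH]; first by rewrite big_ord0 /Int subrr.
  by rewrite big_ord_recr /= IH Int_cat.
have e0 i : 0 <= e i by rewrite divr_ge0 ?exprn_ge0.
have cQ := @continuous_riesz2 R t N.
apply: (@le_trans _ _ (\sum_(i < M) 2 * Int (riesz2 N) (e i) (e i.+1))).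
  apply: ler_sum => i _.
  have iN : (i.+1 * r <= N)%N by apply: leq_trans MN; rewrite leq_mul2r ltn_ord orbT.
  have := block_energy_le r (i.+1 * r) (N - i.+1 * r); rewrite subnK //.
  have -> : 4 ^- (N - i.+1 * r) = e i.+1.
    by rewrite /e -{2}(subnK iN) exprD; field; rewrite !exp4_neq0.
  have -> : e i.+1 * 4 ^- r = e i by rewrite /e mulSn exprD; field; rewrite !exp4_neq0.
  by [].
rewrite -mulr_sumr tel ler_pM2l // /energy.
rewrite -(Int_cat _ 0 (e 0) 1) -(Int_cat _ (e 0) (e M) 1).
have eM : e M <= 1.
  by rewrite /e ler_pdivrMr ?exprn_gt0 // mul1r ler_weXn2l // ler1n.
have h1 : 0 <= Int (riesz2 N) 0 (e 0) by apply: Int_ge0 => // y _; exact: riesz2_ge0.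
have h2 : 0 <= Int (riesz2 N) (e M) 1 by apply: Int_ge0 => // y _; exact: riesz2_ge0.
by lra.
Qed.

(** Grouped as a function of [y] times a function of [t * y], the form in which averaging over [t]
    separates the two. *)
Definition block_term L l l' y := (riesz L y * dyadic l.*2 y) * (riesz L (t * y) * dyadic l'.*2 (t * y)).

Lemma continuous_block_term L l l' : continuous (block_term L l l').
Proof.
apply: contM; apply: contM; try exact: continuous_riesz; try exact: continuous_dyadic.
- by apply: cont_comp; [exact: continuous_riesz|exact: continuous_lin].
- by apply: cont_comp; [exact: continuous_dyadic|exact: continuous_lin].
Qed.

Lemma block_le r J L : Int (fun y => riesz2 L (4 ^+ r * y)) (4 ^- r) 1 <=
  64 ^+ r * 16 ^+ J.+1 * Int (riesz2 (r + L)) (4 ^- r) 1 +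
  3 * \sum_(l < J.+1) Int (fun y => block_term L l (J - l) (4 ^+ r * y)) (4 ^- r) 1.
Proof.
have ct l : continuous (fun y => block_term L l (J - l) (4 ^+ r * y)).
  by apply: cont_comp; [exact: continuous_block_term|exact: continuous_lin].
have cs : continuous (fun y => \sum_(l < J.+1) block_term L l (J - l) (4 ^+ r * y)).
  by apply: cont_sum => l; exact: ct.
rewrite -IntZ; last exact: continuous_riesz2.
rewrite -(Int_sum (index_enum 'I_J.+1) _ _ (fun l => ct (val l))) -IntZ; last exact: cs.
rewrite -IntD; last 2 first.
- by apply: contZ; exact: continuous_riesz2.
- exact: contZ.
apply: le_Int.
- exact: continuous_riesz2M.
- by apply: contD; apply: contZ => //; exact: continuous_riesz2.
- exact: exp4V_le1.
move=> y _; have := pointwise_le r J t y.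
have := riesz2_ge0 t L (4 ^+ r * y) => M0 H.
have := ler_wpM2r M0 H; rewrite mul1r => /le_trans; apply.
rewrite mulrDl riesz2D -(mulrA 3) mulr_suml; apply: eq_ler; congr (_ + 3 * _).
  by rewrite /riesz2; ring.
by apply: eq_bigr => l _; rewrite /block_term /riesz2; ring.
Qed.

(* The exponent 37 is kept as a variable [e]: unary [2 ^ 37] must never be evaluated. *)
Lemma one_le_sum_block_term e K k0 k N : (37 <= e)%N -> (K = 2 ^ k)%N -> (k <= k0)%N ->
  (2 ^ e * 16 ^ k0 * (k0 + 4) <= N)%N ->
  (forall n, (n <= N)%N -> (npairs t n <= 2 * K * 4 ^ n)%N) ->
  forall r J M, r = (k./2 + 4)%N -> J = (k0 - k)%N -> M = (2 ^ e * 16 ^ k0)%N ->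
  1 <= 24 / M%:R * \sum_(i < M) \sum_(l < J.+1)
    Int (fun y => block_term (i * r) l (J - l) (4 ^+ r * y)) (4 ^- r) 1.
Proof.
move=> e37 KE kk0 MN tK r J M rE JE ME.
have GK n : (n <= N)%N -> energy n <= 32 * K%:R.
  move=> nN; apply: le_trans (energy_le t n) _.
  rewrite ler_pdivrMr ?exprn_gt0 // -natrX -!natrM ler_nat.
  by have := tK n nN; lia.
have rk : (r <= k0 + 4)%N.
  rewrite rE leq_add2r; apply: leq_trans kk0; rewrite -{2}(odd_double_half k) -addnn addnCA.
  exact: leq_addr.
have kE := odd_double_half k.
(* The 4 in [r = k./2 + 4] provides [128 = 2 ^ 7] and one more bit for the rounding of [k./2]. *)
have Kr : 128 * K%:R <= 4 ^+ r :> R.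
  rewrite -natrX -natrM ler_nat KE rE (_ : 128 = 2 ^ 7)%N // (_ : 4 = 2 ^ 2)%N //.
  by rewrite -expnM -expnD leq_exp2l //; case: (odd k) kE => /=; lia.
have r64 : (6 * r <= 24 + 3 * k)%N by move: kE; rewrite rE; lia.
have Mr : (M * r <= N)%N by apply: leq_trans MN; rewrite ME leq_mul2l rk orbT.
have M0 : 0 < M%:R :> R by rewrite ltr0n ME muln_gt0 !expn_gt0.
set Psi := \sum_(i < M) _.
have key : M%:R / 4 <= 64 ^+ r * 16 ^+ J.+1 * (2 * energy N) + 3 * Psi.
  apply: le_trans (_ : \sum_(i < M) (64 ^+ r * 16 ^+ J.+1 * Int (riesz2 (i.+1 * r)) (4 ^- r) 1 +
     3 * \sum_(l < J.+1) Int (fun y => block_term (i * r) l (J - l) (4 ^+ r * y)) (4 ^- r) 1) <= _).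
    rewrite (_ : M%:R / 4 = \sum_(i < M) (1 / 4 : R)); last first.
      by rewrite sumr_const card_ord -[RHS]mulr_natl div1r.
    apply: ler_sum => i _.
    have iN : (i * r <= N)%N.
      by apply: leq_trans Mr; rewrite leq_mul2r ltnW ?orbT.
    apply: le_trans (block_mass (GK _ iN) Kr) _.
    by rewrite mulSn; exact: block_le.
  rewrite big_split /= -!mulr_sumr lerD2r; apply: ler_wpM2l.
    by rewrite mulr_ge0 ?exprn_ge0.
  exact: sum_block_energy_le.
(* Origin of 37: the exponents of 2 are at most [24 + 3 k] for [64 ^ r], [4 J + 4] for
   [16 ^ (J + 1)], [6 + k] for [64 K] and 3 for the division by 8, in total [37 + 4 k0]. *)
have small : 64 ^+ r * 16 ^+ J.+1 * (2 * energy N) <= M%:R / 8.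
  apply: (@le_trans _ _ (64 ^+ r * 16 ^+ J.+1 * (64 * K%:R))).
    apply: ler_wpM2l; first by rewrite mulr_ge0 ?exprn_ge0.
    by have := GK N (leqnn _); lra.
  rewrite ler_pdivlMr // -!natrX -!natrM ler_nat.
  rewrite ME KE -(subnKC kk0) -JE.
  rewrite (_ : 64 = 2 ^ 6)%N // (_ : 16 = 2 ^ 4)%N // (_ : 8 = 2 ^ 3)%N //.
  by rewrite -!expnM -!expnD leq_exp2l //; lia.
rewrite mulrAC ler_pdivlMr //; lra.
Qed.

End blocks.

(** * Mean values of periodic products *)

Section periodic.
Variable R : realType.
Implicit Types (f g : R -> R) (a b x : R).

Local Notation tp := (2 * @pi R).

Lemma tp_gt0 : 0 < tp. Proof. by rewrite mulr_gt0 ?pi_gt0. Qed.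

Definition periodic2pi f := forall x, f (x + tp) = f x.

Lemma per_mulrn f n x : periodic2pi f -> f (x + n%:R * tp) = f x.
Proof.
move=> pf; elim: n x => [|n IH] x; first by rewrite mul0r addr0.
by rewrite -natr1 mulrDl mul1r addrA pf IH.
Qed.

Lemma per_scale f n : periodic2pi f -> periodic2pi (fun x => f (n%:R * x)).
Proof. by move=> pf x; rewrite mulrDr per_mulrn. Qed.

Lemma per_prod (T : Type) (s : seq T) (F : T -> R -> R) :
  (forall i, periodic2pi (F i)) -> periodic2pi (fun x => \prod_(i <- s) F i x).
Proof. by move=> pF x; apply: eq_bigr => i _; rewrite pF. Qed.

Lemma per_onecos : periodic2pi (@onecos R).
Proof. by move=> x; rewrite /onecos mulr_natl cosD2pi. Qed.

Lemma per_riesz n : periodic2pi (@riesz R n).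
Proof. by apply: per_prod => i; rewrite -natrX; exact: per_scale per_onecos. Qed.

Lemma per_dyadic n : periodic2pi (@dyadic R n).
Proof.
apply: per_prod => i x; rewrite -natrX.
by rewrite (per_scale _ per_onecos).
Qed.

Lemma Int_shift f a b : continuous f -> periodic2pi f -> Int f (a + tp) (b + tp) = Int f a b.
Proof.
move=> cf pf; have := Int_affine 1 tp a b cf; rewrite !mul1r => <-.
by congr Int; apply/funext => x; rewrite mul1r pf.
Qed.

Lemma Int_period f a : continuous f -> periodic2pi f -> Int f a (a + tp) = Int f 0 tp.
Proof. by move=> cf pf; have := Int_shift 0 a cf pf; rewrite add0r /Int; lra. Qed.

Lemma Int_periods f a n : continuous f -> periodic2pi f ->
  Int f a (a + n%:R * tp) = n%:R * Int f 0 tp.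
Proof.
move=> cf pf; elim: n => [|n IH]; first by rewrite !mul0r addr0 /Int subrr.
have -> : a + n.+1%:R * tp = a + n%:R * tp + tp by rewrite -natr1; ring.
rewrite -(Int_cat _ _ (a + n%:R * tp)) IH Int_period // -natr1; ring.
Qed.

Lemma Int_le_periods f a b : continuous f -> periodic2pi f -> (forall x, 0 <= f x) -> a <= b ->
  Int f a b <= ((b - a) / tp + 1) * Int f 0 tp.
Proof.
move=> cf pf f0 ab; have p0 := tp_gt0.
have A0 : 0 <= Int f 0 tp by apply: Int_ge0 => //; exact: ltW.
have c0 : 0 <= (b - a) / tp by rewrite divr_ge0 ?subr_ge0 // ltW.
pose n := (Num.truncn ((b - a) / tp)).+1.
have bn : b <= a + n%:R * tp.
  by rewrite addrC -lerBlDr -ler_pdivrMr // ltW // truncnS_gt.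
apply: (@le_trans _ _ (Int f a (a + n%:R * tp))).
  by rewrite -(Int_cat _ a b (a + n%:R * tp)) lerDl Int_ge0.
rewrite Int_periods //; apply: ler_wpM2r => //.
by rewrite /n -natr1 lerD2r truncn_le.
Qed.

Lemma Int_double_period f : continuous f -> periodic2pi f ->
  Int (fun x => f (2 * x)) 0 tp = Int f 0 tp.
Proof.
move=> cf pf; have := Int_affine 2 0 0 tp cf.
under eq_fun do rewrite addr0.
rewrite mulr0 !addr0 => H; have := Int_periods 0 2 cf pf.
rewrite add0r -H; lra.
Qed.

(* [cos] changes sign under the translation by [pi], while [f (2 x)] does not. *)
Lemma Int_onecos_double f : continuous f -> periodic2pi f ->
  Int (fun x => onecos x * f (2 * x)) 0 tp = Int f 0 tp.
Proof.
move=> cf pf.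
have c2 : continuous (fun x => f (2 * x)) by apply: cont_comp => //; exact: continuous_lin.
have cc : continuous (fun x => cos x * f (2 * x)) by apply: contM => //; exact: continuous_cos.
rewrite (_ : (fun x => _) = fun x => f (2 * x) + cos x * f (2 * x)); last first.
  by apply/funext => x; rewrite /onecos; ring.
rewrite IntD // Int_double_period // -(Int_cat (fun x => cos x * f (2 * x)) 0 pi tp).
have -> : Int (fun x => cos x * f (2 * x)) pi tp = Int (fun x => cos x * f (2 * x)) pi (pi + pi).
  by congr Int; ring.
have := Int_affine 1 pi 0 pi cc; rewrite !mul1r add0r => <-.
rewrite [X in _ + (_ + Int X _ _)](_ : _ = fun x => (-1) * (cos x * f (2 * x))).
  by rewrite IntZ //; ring.
by apply/funext => x; rewrite mul1r cosDpi mulrDr pf; ring.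
Qed.

(** Each factor of [dyadic] has mean [1 / 2] and is uncorrelated with everything of at least twice
    its frequency. *)
Lemma Int_dyadic f m : continuous f -> periodic2pi f ->
  Int (fun x => dyadic m x * f (2 ^+ m * x)) 0 tp = Int f 0 tp / 2 ^+ m.
Proof.
move=> cf pf; elim: m => [|m IH].
  rewrite expr0 divr1; congr Int; apply/funext => x.
  by rewrite /dyadic big_ord0 !mul1r.
pose g x := dyadic m x * f (2 ^+ m * x).
have cg : continuous g.
  apply: contM; first exact: continuous_dyadic.
  by apply: cont_comp => //; exact: continuous_lin.
have pg : periodic2pi g by move=> x; rewrite /g per_dyadic -natrX (per_scale _ pf).
rewrite exprS invfM mulrCA -IH -/g -(Int_onecos_double cg pg) -IntZ; last first.
  apply: contM; first exact: continuous_onecos.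
  by apply: cont_comp => //; exact: continuous_lin.
congr Int; apply/funext => x; rewrite dyadicS /g (_ : 2 * 2 ^+ m * x = 2 ^+ m * (2 * x)); last by ring.
by ring.
Qed.

Lemma Int_riesz n : Int (riesz n) 0 tp = tp.
Proof.
elim: n => [|n IH].
  have d (z : R) : is_derive z 1 id (riesz 0 z) by rewrite /riesz big_ord0; exact: is_derive_id.
  by rewrite (IntE _ _ d) subr0.
rewrite (_ : riesz n.+1 = fun x => onecos x * (fun x => riesz n (2 * x)) (2 * x)); last first.
  by apply/funext => x; rewrite rieszS; congr (_ * riesz _ _); ring.
have cQ := @continuous_riesz R n.
have p2 : periodic2pi (fun x => riesz n (2 * x)) by exact: per_scale (per_riesz n).
rewrite (Int_onecos_double _ p2) ?Int_double_period //; first exact: per_riesz.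
by apply: cont_comp => //; exact: continuous_lin.
Qed.

Definition riesz_dyadic L l x := riesz L x * dyadic l.*2 x.

Lemma riesz_dyadic_ge0 L l x : 0 <= riesz_dyadic L l x. Proof. by rewrite mulr_ge0 ?riesz_ge0 ?dyadic_ge0. Qed.

Lemma continuous_riesz_dyadic L l : continuous (riesz_dyadic L l).
Proof. by apply: contM; [exact: continuous_riesz|exact: continuous_dyadic]. Qed.

Lemma per_riesz_dyadic L l : periodic2pi (riesz_dyadic L l).
Proof. by move=> x; rewrite /riesz_dyadic per_riesz per_dyadic. Qed.

(** The first [l] factors of [riesz] overlap in frequency with [dyadic l.*2] and are bounded by
    [2 ^ l]; the others have frequency at least [4 ^ l] and decouple. This leaves
    [2 ^ l / 4 ^ l]. *)
Lemma Int_riesz_dyadic_le L l : Int (riesz_dyadic L l) 0 tp <= tp / 2 ^+ l.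
Proof.
have cQ : continuous (fun x => riesz (L - l) (2 ^+ l.*2 * x)).
  by apply: cont_comp; [exact: continuous_riesz|exact: continuous_lin].
have chQ : continuous (fun x => dyadic l.*2 x * riesz (L - l) (2 ^+ l.*2 * x)).
  by apply: contM => //; exact: continuous_dyadic.
apply: (@le_trans _ _ (Int (fun x => 2 ^+ l * (dyadic l.*2 x * riesz (L - l) (2 ^+ l.*2 * x))) 0 tp)).
  apply: le_Int; [exact: continuous_riesz_dyadic|exact: contZ|exact: ltW tp_gt0|].
  move=> x _; rewrite /riesz_dyadic mulrC mulrCA; apply: ler_wpM2l; first exact: dyadic_ge0.
  have [lL|Ll] := leqP l L.
    have -> : riesz L x = riesz l x * riesz (L - l) (4 ^+ l * x) by rewrite -rieszD subnKC.
    rewrite -mul2n exprM (_ : 2 ^+ 2 = 4 :> R); last by rewrite -natrX.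
    by apply: ler_wpM2r; [exact: riesz_ge0|exact: riesz_le].
  (* For [L < l] the truncated difference is 0: no high factor remains. *)
  rewrite (eqP (ltnW Ll : (L - l)%N == 0%N)) [X in _ <= _ * X]/riesz big_ord0 mulr1.
  by apply: le_trans (riesz_le _ _) _; rewrite ler_weXn2l ?ler1n // ltnW.
rewrite IntZ // Int_dyadic; [|exact: continuous_riesz|exact: per_riesz].
rewrite Int_riesz -addnn exprD; apply: eq_ler; field; rewrite expf_neq0 //.
Qed.

Lemma tp_le8 : tp <= 8.
Proof. by have := pihalf_lt2 R; lra. Qed.

Lemma Int_riesz_dyadic_sym_le L l b : 1 <= b -> Int (riesz_dyadic L l) (- b) b <= 10 * b / 2 ^+ l.
Proof.
move=> b1; have p0 := tp_gt0; have p8 := tp_le8.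
apply: le_trans (Int_le_periods (@continuous_riesz_dyadic L l) (@per_riesz_dyadic L l) (@riesz_dyadic_ge0 L l) _) _.
  by lra.
apply: (@le_trans _ _ (((b - - b) / tp + 1) * (tp / 2 ^+ l))).
  apply: ler_wpM2l; last exact: Int_riesz_dyadic_le.
  by rewrite addr_ge0 // divr_ge0 // ?ltW //; lra.
rewrite mulrA; apply: ler_wpM2r; first by rewrite invr_ge0 exprn_ge0.
by rewrite mulrDl divfK ?gt_eqF //; lra.
Qed.

Lemma Int_riesz_dyadic_scaled_le L l r :
  Int (fun y => riesz_dyadic L l (4 ^+ r * y)) (4 ^- r) 1 <= 10 / 2 ^+ l.
Proof.
have p0 := tp_gt0; have p8 := tp_le8.
have e0 : 0 < 4 ^+ r :> R by rewrite exprn_gt0.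
have e1 : 1 <= 4 ^+ r :> R by rewrite exprn_ege1 // ler1n.
have := Int_affine (4 ^+ r) 0 (4 ^- r) 1 (@continuous_riesz_dyadic L l).
under eq_fun do rewrite addr0.
rewrite !addr0 mulfV ?exp4_neq0 // mulr1 => H.
rewrite -(ler_pM2l e0) H.
apply: le_trans (Int_le_periods (@continuous_riesz_dyadic L l) (@per_riesz_dyadic L l) (@riesz_dyadic_ge0 L l) e1) _.
apply: (@le_trans _ _ (((4 ^+ r - 1) / tp + 1) * (tp / 2 ^+ l))).
  apply: ler_wpM2l; last exact: Int_riesz_dyadic_le.
  by rewrite addr_ge0 // divr_ge0 ?subr_ge0 // ltW.
rewrite [leLHS]mulrA [leRHS]mulrA; apply: ler_wpM2r; first by rewrite invr_ge0 exprn_ge0.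
by rewrite mulrDl divfK ?gt_eqF //; lra.
Qed.

End periodic.

(** * Averaging over directions *)

Section tonelli_box.
Variable R : realType.
Local Notation mu := (@lebesgue_measure R).
Variable g : R -> R -> R.
Hypothesis g0 : forall s y, 0 <= g s y.
Hypothesis mg : measurable_fun setT (fun z : R * R => g z.1 z.2).

Lemma measurable_integral_box (A B : set R) : measurable A -> measurable B ->
  measurable_fun A ((fun s => \int[mu]_(y in B) (g s y)%:E)%E : R -> \bar R).
Proof.
move=> mA mB.
pose f (z : R * R) : \bar R := (\1_B z.2 * g z.1 z.2)%:E.
have mf : measurable_fun setT f.
  apply/measurable_EFinP; apply: measurable_funM => //.
  by apply: measurableT_comp => //; exact: measurable_indic.
have f0 z : (0 <= f z)%E by rewrite lee_fin mulr_ge0.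
have := measurable_fun_fubini_tonelli_F (m2 := mu) f mf f0.
move=> /(measurable_funS (@measurableT _ _) (@subsetT _ A)); apply: eq_measurable_fun.
move=> s _; rewrite /fubini_F [RHS]integral_mkcond; apply: eq_integral => y _.
rewrite /f patchE /= indicE; by case: ifPn => yB; rewrite ?mul1r ?mul0r.
Qed.

Lemma tonelli_box (A B : set R) : measurable A -> measurable B ->
  (\int[mu]_(s in A) \int[mu]_(y in B) (g s y)%:E =
   \int[mu]_(y in B) \int[mu]_(s in A) (g s y)%:E)%E.
Proof.
move=> mA mB.
pose f (z : R * R) : \bar R := (\1_A z.1 * \1_B z.2 * g z.1 z.2)%:E.
have mf : measurable_fun setT f.
  apply/measurable_EFinP; apply: measurable_funM => //.
  by apply: measurable_funM; apply: measurableT_comp => //; exact: measurable_indic.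
have f0 z : (0 <= f z)%E by rewrite lee_fin !mulr_ge0.
have := fubini_tonelli (m1 := mu) (m2 := mu) f mf f0.
rewrite [LHS](_ : _ = (\int[mu]_(s in A) \int[mu]_(y in B) (g s y)%:E)%E); last first.
  rewrite [RHS]integral_mkcond; apply: eq_integral => s _.
  rewrite patchE; case: ifPn => [sA|/negPf sA].
    rewrite [RHS]integral_mkcond; apply: eq_integral => y _.
    rewrite patchE /f /= !indicE sA mul1r.
    by case: ifPn => yB; rewrite ?mul1r ?mul0r.
  by rewrite integral0_eq // => y _; rewrite /f /= indicE sA !mul0r.
move=> ->.
rewrite [RHS]integral_mkcond; apply: eq_integral => y _.
rewrite patchE; case: ifPn => [yB|/negPf yB].
  rewrite [RHS]integral_mkcond; apply: eq_integral => s _.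
  rewrite patchE /f /= !indicE yB mulr1.
  by case: ifPn => sA; rewrite ?mul1r ?mul0r.
by rewrite integral0_eq // => s _; rewrite /f /= !indicE yB mulr0 mul0r.
Qed.

End tonelli_box.

Section arcs.
Variable R : realType.
Local Notation mu := (@lebesgue_measure R).

Lemma measurable_tan : measurable_fun setT (@tan R).
Proof.
pose D : set R := [set x | cos x != 0].
have oD : open D.
  have -> : D = cos @^-1` [set y | y != 0] by [].
  by apply: open_comp; [move=> x _; exact: continuous_cos|exact: open_neq].
(* The inverse of 0 is 0, so [tan] vanishes where [cos] does and equals its restriction extended by
   0. *)
have -> : @tan R = tan \_ D.
  apply/funext => x; rewrite patchE; case: ifPn => // /negP xD.
  have /eqP c0 : cos x == 0 by apply/negPn/negP => c0; apply: xD; rewrite inE.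
  by rewrite /tan c0 invr0 mulr0.
apply/(measurable_restrictT _ _).1; first exact: open_measurable.
apply: open_continuous_measurable_fun => // x; rewrite inE => xD.
exact: continuous_tan.
Qed.

Variables (sg c a b : R).
Hypothesis sg1 : `|sg| = 1.
Hypothesis ab : a < b.
Local Notation tau s := (tan (sg * s + c)).
Hypothesis cosn0 : forall s, a <= s <= b -> cos (sg * s + c) != 0.
Hypothesis tan1 : forall s, a <= s <= b -> `|tau s| <= 1.

Lemma measurable_tau : measurable_fun setT (fun s => tau s).
Proof.
apply: measurableT_comp; first exact: measurable_tan.
by apply: continuous_measurable_fun; exact: cont_affine.
Qed.

(* Substitution [x = be * tau s], whose derivative is at least [be] in absolute value. *)
Lemma integral_arc_le (v : R -> R) (be : R) : continuous v -> (forall x, 0 <= v x) -> 0 < be ->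
  (\int[mu]_(s in `[a, b]) (v (tau s * be))%:E <= (be^-1 * Int v (- be) be)%:E)%E.
Proof.
move=> cv v0 be0.
pose w s := v (tau s * be) * (cos (sg * s + c)) ^- 2.
pose D s := sg / be * prim v (tau s * be).
have dv := is_derive_prim cv.
have dtau s : a <= s <= b -> is_derive s 1 (fun s => tau s * be)
    (be * (sg * (cos (sg * s + c)) ^- 2)).
  move=> sab.
  have h2 : is_derive s 1 (fun x => sg * x + c) sg.
    by apply: is_derive_eq; rewrite addr0 /GRing.scale /= mulr1.
  have h3 := @is_derive1_comp R (@tan R) (fun x => sg * x + c) s _ _ (is_derive_tan (cosn0 sab)) h2.
  by apply: is_derive_eq; rewrite /GRing.scale /=; ring.
have dD s : a <= s <= b -> is_derive s 1 D (w s).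
  move=> sab; have h := @is_derive1_comp R (prim v) (fun s => tau s * be) s _ _ (dv (tau s * be)) (dtau s sab).
  apply: is_derive_eq; rewrite /GRing.scale /= /w.
  have : sg * sg = 1 by rewrite -expr2 -real_normK ?num_real // sg1 expr1n.
  move=> sg2; rewrite [LHS](_ : _ = sg * sg * (v (tau s * be) * cos (sg * s + c) ^- 2)).
    by rewrite sg2 mul1r.
  by field; rewrite (gt_eqF be0) cosn0.
have cw s : a <= s <= b -> {for s, continuous w}.
  move=> sab.
  have c1 : {for s, continuous (fun s => v (tau s * be))}.
    apply: (@continuous_comp _ _ _ (fun s => tau s * be) v); last exact: cv.
    exact: is_derive_continuous (dtau s sab).
  have c2 : {for s, continuous (fun s => (cos (sg * s + c)) ^- 2)}.
    apply: (@continuousV _ _ (fun s => cos (sg * s + c) ^+ 2)).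
      by rewrite expf_neq0 // cosn0.
    have ccos : continuous (fun s => cos (sg * s + c)).
      by apply: cont_comp; [exact: continuous_cos|exact: cont_affine].
    by apply: (contM ccos ccos).
  exact: (continuousM c1 c2).
have v_le_w s : a <= s <= b -> v (tau s * be) <= w s.
  move=> sab; have p : 0 < cos (sg * s + c) ^+ 2 by rewrite exprn_even_gt0 ?cosn0.
  by rewrite /w ler_peMr // invf_ge1 //.
apply: (@le_trans _ _ (\int[mu]_(s in `[a, b]) (w s)%:E)%E).
  apply: ge0_le_integral => //.
  - by move=> s _; rewrite lee_fin.
  - apply/measurable_EFinP; apply: measurable_funTS.
    apply: measurableT_comp; first exact: continuous_measurable_fun.
    by apply: measurable_funM => //; exact: measurable_tau.
  - apply/measurable_EFinP; apply: subspace_continuous_measurable_fun => //.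
    by apply: continuous_in_subspaceT => s; rewrite inE /= in_itv /=; exact: cw.
have aab : a <= a <= b by rewrite lexx ltW.
have bab : a <= b <= b by rewrite lexx ltW.
rewrite (@continuous_FTC2 _ w D) //.
- rewrite -EFinB lee_fin /D.
  have mono x y : x <= y -> prim v x <= prim v y.
    by move=> xy; rewrite -subr_ge0; exact: (Int_ge0 cv xy).
  have bd s : a <= s <= b -> prim v (- be) <= prim v (tau s * be) <= prim v be.
    move=> /tan1; rewrite ler_norml => /andP[t1 t2].
    by rewrite !mono //; nra.
  have /andP[] := bd _ aab; have /andP[] := bd _ bab.
  move=> h1 h2 h3 h4; rewrite -mulrBr (mulrC sg) -mulrA ler_pM2l ?invr_gt0 // /Int.
  have [sE|sE] : sg = 1 \/ sg = -1.
    have [h|h] := leP 0 sg; first by left; rewrite -(ger0_norm h).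
    by right; rewrite -sg1 ltr0_norm // opprK.
  - by rewrite {1}sE mul1r; lra.
  - by rewrite {1}sE mulN1r; lra.
- by apply: continuous_in_subspaceT => s; rewrite inE /= in_itv /=; exact: cw.
- split.
  + move=> s; rewrite in_itv /= => /andP[s1 s2].
    by have [] := dD s; rewrite ?(ltW s1) ?(ltW s2).
  + by apply: cvg_at_right_filter; apply: is_derive_continuous (dD _ aab).
  + by apply: cvg_at_left_filter; apply: is_derive_continuous (dD _ bab).
- move=> s; rewrite in_itv /= => /andP[s1 s2].
  by rewrite derive1E; have [] := dD s; rewrite ?(ltW s1) ?(ltW s2).
Qed.

(** The integral over the direction is taken first. As [y >= 4 ^- r], the variable
    [4 ^ r * y * tau s] sweeps an interval of half-length at least 1, so the second factor averages
    to [10 / 2 ^ l'] uniformly in [y]; the first factor then gives [10 / 2 ^ l]. *)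
Lemma integral_block_term_le L l l' r :
  measurable_fun `[a, b] (fun s => (Int (fun y => block_term (tau s) L l l' (4 ^+ r * y)) (4 ^- r) 1)%:E) /\
  (\int[mu]_(s in `[a, b]) (Int (fun y => block_term (tau s) L l l' (4 ^+ r * y)) (4 ^- r) 1)%:E
    <= (100 / 2 ^+ (l + l'))%:E)%E.
Proof.
pose g s y := riesz_dyadic L l (4 ^+ r * y) * riesz_dyadic L l' (tau s * (4 ^+ r * y)).
have g0 s y : 0 <= g s y by rewrite mulr_ge0 ?riesz_dyadic_ge0.
have cu : continuous (fun y : R => riesz_dyadic L l (4 ^+ r * y)).
  by apply: cont_comp; [exact: continuous_riesz_dyadic|exact: continuous_lin].
have mg : measurable_fun setT (fun z : R * R => g z.1 z.2).
  apply: measurable_funM.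
    exact: (measurableT_comp (continuous_measurable_fun cu) measurable_snd).
  apply: measurableT_comp; first by apply: continuous_measurable_fun; exact: continuous_riesz_dyadic.
  apply: measurable_funM.
    exact: (measurableT_comp measurable_tau measurable_fst).
  by apply: measurable_funM => //; exact: measurable_snd.
have E s : (Int (fun y => block_term (tau s) L l l' (4 ^+ r * y)) (4 ^- r) 1)%:E =
   (\int[mu]_(y in `[4 ^- r, 1%R]) (g s y)%:E)%E.
  rewrite integral_Int ?exp4V_le1 //.
  apply: contM => //; apply: cont_comp; first exact: continuous_riesz_dyadic.
  by apply: cont_comp; [exact: continuous_lin|exact: continuous_lin].
rewrite (funext E); split; first exact: measurable_integral_box.
rewrite tonelli_box //.
have Q100 : 10 / 2 ^+ l' * (10 / 2 ^+ l) = 100 / 2 ^+ (l + l') :> R.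
  by rewrite exprD; field; rewrite !expf_neq0.
apply: (@le_trans _ _ (\int[mu]_(y in `[4 ^- r, 1%R])
   (10 / 2 ^+ l' * riesz_dyadic L l (4 ^+ r * y))%:E)%E).
  apply: ge0_le_integral => //.
  - by move=> y _; apply: integral_ge0 => s _; rewrite lee_fin.
  - have mg' : measurable_fun setT (fun z : R * R => g z.2 z.1).
      rewrite (_ : (fun z => _) = (fun z : R * R => g z.1 z.2) \o (fun z => (z.2, z.1))) //.
      apply: measurableT_comp => //; exact: measurable_swap.
    exact: (@measurable_integral_box _ (fun y s => g s y)).
  - apply/measurable_EFinP; apply: measurable_funTS.
    by apply: continuous_measurable_fun; exact: contZ.
  - move=> y /=; rewrite in_itv /= => /andP[y0 y1].
    have be1 : 1 <= 4 ^+ r * y by rewrite mulrC -ler_pdivrMr ?exprn_gt0 // div1r.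
    have be0 : 0 < 4 ^+ r * y by exact: lt_le_trans be1.
    under eq_integral do rewrite EFinM.
    rewrite ge0_integralZl_EFin ?riesz_dyadic_ge0 //; last 2 first.
    + by move=> s _; rewrite lee_fin riesz_dyadic_ge0.
    + apply/measurable_EFinP; apply: measurable_funTS.
      apply: measurableT_comp; first by apply: continuous_measurable_fun; exact: continuous_riesz_dyadic.
      by apply: measurable_funM => //; exact: measurable_tau.
    rewrite [leRHS]EFinM [leRHS]muleC; apply: lee_wpmul2l; first by rewrite lee_fin riesz_dyadic_ge0.
    apply: le_trans (integral_arc_le (@continuous_riesz_dyadic R L l') (@riesz_dyadic_ge0 R L l') be0) _.
    rewrite lee_fin ler_pdivrMl //; apply: le_trans (Int_riesz_dyadic_sym_le _ _ be1) _.
    by apply: eq_ler; ring.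
rewrite integral_Int ?exp4V_le1 //; last exact: contZ.
rewrite IntZ // lee_fin -Q100; apply: ler_wpM2l; first by rewrite divr_ge0 ?exprn_ge0.
exact: Int_riesz_dyadic_scaled_le.
Qed.

End arcs.

(** * An integrable majorant of the covering length *)

Section majorant.
Variables (R : realType) (e : nat).
Hypothesis e37 : (37 <= e)%N.

Definition nblocks (k0 : nat) : nat := (2 ^ e * 16 ^ k0)%N.

(** The stage of [covered_of_npairs] at the largest threshold [2 ^ k0], hence sufficient for every
    smaller one. *)
Definition nstages (k0 : nat) : nat :=
  (24 * 2 ^ k0 * k0 * (nblocks k0 * (k0 + 4)))%N.

(** By [one_le_sum_block_term] it is at least 1 in directions where the pair counts stay below the
    threshold for [2 ^ k]; it replaces their indicator, as in Markov's inequality. *)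
Definition summand (k0 k : nat) (t : R) : R := 24 / (nblocks k0)%:R *
  \sum_(i < nblocks k0) \sum_(l < (k0 - k).+1)
    Int (fun y => block_term t (i * (k./2 + 4)) l (k0 - k - l) (4 ^+ (k./2 + 4) * y))
      (4 ^- (k./2 + 4)) 1.

Definition majorant (k0 : nat) (t : R) : R :=
  2 ^- k0 + \sum_(k < k0.+1) 2 ^- k * summand k0 k t.

Lemma summand_ge0 k0 k t : 0 <= summand k0 k t.
Proof.
rewrite mulr_ge0 // ?divr_ge0 //; apply: sumr_ge0 => i _; apply: sumr_ge0 => l _.
apply: Int_ge0; last by move=> y _; rewrite !mulr_ge0 ?riesz_ge0 ?dyadic_ge0.
- by apply: cont_comp; [exact: continuous_block_term|exact: continuous_lin].
- exact: exp4V_le1.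
Qed.

Lemma majorant_ge k0 k t : (k <= k0)%N -> 2 ^- k * summand k0 k t <= majorant k0 t.
Proof.
move=> kk0; have kk0' : (k < k0.+1)%N by [].
rewrite /majorant (bigD1 (Ordinal kk0')) //= addrCA lerDl addr_ge0 ?invr_ge0 ?exprn_ge0 //.
by apply: sumr_ge0 => i _; rewrite mulr_ge0 ?invr_ge0 ?exprn_ge0 ?summand_ge0.
Qed.

Lemma majorant_ge_last k0 t : 2 ^- k0 <= majorant k0 t.
Proof.
rewrite /majorant lerDl; apply: sumr_ge0 => i _.
by rewrite mulr_ge0 ?invr_ge0 ?exprn_ge0 ?summand_ge0.
Qed.

(** Take the least good [k]. If [k = m + 1], failure at [m] gives length [12 / 2 ^ m = 24 / 2 ^ k],
    and [summand k0 k t >= 1] pays for it. If [k = 0], the trivial cover of length 3 suffices; if no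
    [k <= k0] is good, the term [2 ^- k0] pays. *)
Lemma covered_majorant k0 t : `|t| <= 1 ->
  covered t (nstages k0) (24 * majorant k0 t).
Proof.
move=> t1; set N := (nblocks k0 * (k0 + 4))%N.
pose good k := forall n, (n <= N)%N -> (npairs t n <= 2 * 2 ^ k * 4 ^ n)%N.
have one k : (k <= k0)%N -> good k -> 1 <= summand k0 k t.
  by move=> kk0 gk; apply: (one_le_sum_block_term t1 e37 (erefl (2 ^ k)%N) kk0 (leqnn _)).
have cov k : (k <= k0)%N -> ~ good k -> covered t (nstages k0) (12 / (2 ^ k)%:R).
  move=> kk0 /existsNP[n /not_implyP[nN /negP]]; rewrite -ltnNge => Tn.
  have k2 : (2 ^ k <= 2 ^ k0)%N by rewrite leq_exp2l.
  have := covered_of_npairs t1 (_ : 0 < 2 ^ k)%N k2 nN Tn.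
  rewrite expn_gt0 => /(_ isT); apply: covered_mono => //.
  by rewrite /nstages -/N !leq_mul2r leq_mul2l k2 !orbT.
have [[k kk0 gk]|none] := pselect (exists2 k, (k <= k0)%N & good k); last first.
  apply: covered_le (cov k0 (leqnn _) _); last by move=> g; apply: none; exists k0.
  by rewrite natrX; have := majorant_ge_last k0 t; have : 0 <= 2 ^- k0 :> R by []; lra.
have exg : exists k, `[< (k <= k0)%N /\ good k >] by exists k; apply/asboolP.
case: (ex_minnP exg) => -[|m] /asboolP[mk0 gm] mmin.
- apply: covered_mono (leq0n _) _ => //; apply: covered_le (covered0 t).
  have := one _ mk0 gm; have := majorant_ge t mk0; rewrite expr0 invr1 mul1r; lra.
- have ngm : ~ good m.
    move=> gm'; have := mmin m; rewrite ltnn => H.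
    by have // : is_true false by apply: H; apply/asboolP; split => //; exact: ltnW.
  apply: covered_le (cov m (ltnW mk0) ngm).
  have := one _ mk0 gm; have := majorant_ge t mk0; rewrite natrX exprS invfM.
  have : 0 <= 2 ^- m :> R by rewrite invr_ge0 exprn_ge0.
  by move: (2 ^- m) (summand _ _ _) (majorant _ _) => x y z; nra.
Qed.

Section bounds.
Variables (a b : R).
Hypothesis ab : a < b.
Local Notation mu := (@lebesgue_measure R).

Definition int_bound (f : R -> R) (B : R) : Prop :=
  [/\ measurable_fun `[a, b] (EFin \o f), (forall x, 0 <= f x) &
    (\int[mu]_(x in `[a, b]) (f x)%:E <= B%:E)%E].

Lemma int_bound_cst c : 0 <= c -> int_bound (cst c) (c * (b - a)).
Proof.
move=> c0; split => //.
  by apply/measurable_EFinP; exact: measurable_cst.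
rewrite (eq_integral (cst c%:E)) // integral_cst //=.
by rewrite lebesgue_measure_itv /= lte_fin ab -EFinB -EFinM.
Qed.

Lemma int_boundD f g B C : int_bound f B -> int_bound g C ->
  int_bound (fun x => f x + g x) (B + C).
Proof.
move=> [mf f0 fB] [mg g0 gC]; split.
- by have := emeasurable_funD mf mg.
- by move=> x; rewrite addr_ge0.
- under eq_integral do rewrite EFinD.
  rewrite ge0_integralD //; last 2 first.
  + by move=> x _; rewrite lee_fin.
  + by move=> x _; rewrite lee_fin.
  by rewrite EFinD leeD.
Qed.

Lemma int_boundZ c f B : 0 <= c -> int_bound f B -> int_bound (fun x => c * f x) (c * B).
Proof.
move=> c0 [mf f0 fB]; split.
- by have := measurable_funeM c%:E mf.
- by move=> x; rewrite mulr_ge0.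
- under eq_integral do rewrite EFinM.
  rewrite ge0_integralZl_EFin //; last by move=> x _; rewrite lee_fin.
  by rewrite EFinM lee_wpmul2l // lee_fin.
Qed.

Lemma int_bound_sum n (f : 'I_n -> R -> R) (B : 'I_n -> R) :
  (forall i, int_bound (f i) (B i)) ->
  int_bound (fun x => \sum_(i < n) f i x) (\sum_(i < n) B i).
Proof.
elim: n f B => [|n IH] f B H.
  rewrite big_ord0; under eq_fun do rewrite big_ord0.
  by have := int_bound_cst (lexx 0); rewrite mul0r.
rewrite big_ord_recr; under eq_fun do rewrite big_ord_recr.
by apply: int_boundD; [exact: IH|exact: H].
Qed.

Variables (sg c : R).
Hypothesis sg1 : `|sg| = 1.
Hypothesis cosn0 : forall s, a <= s <= b -> cos (sg * s + c) != 0.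
Hypothesis tan1 : forall s, a <= s <= b -> `|tan (sg * s + c)| <= 1.
Hypothesis ab2 : b - a <= 2.

Lemma int_bound_summand k0 k : (k <= k0)%N ->
  int_bound (fun s => summand k0 k (tan (sg * s + c)))
    (2400 * (k0 - k).+1%:R / 2 ^+ (k0 - k)).
Proof.
move=> kk0; set J := (k0 - k)%N.
have M0 : (nblocks k0)%:R != 0 :> R.
  by rewrite pnatr_eq0 -lt0n muln_gt0 !expn_gt0.
have -> : 2400 * J.+1%:R / 2 ^+ J = 24 / (nblocks k0)%:R *
    \sum_(i < nblocks k0) \sum_(l < J.+1) (100 / 2 ^+ (l + (J - l))) :> R.
  under eq_bigr do under eq_bigr => l _ do rewrite subnKC ?leq_ord //.
  rewrite !sumr_const !card_ord -[X in _ = _ * X]mulr_natl -[X in _ = _ * (_ * X)]mulr_natl.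
  by field; rewrite M0 expf_neq0.
apply: int_boundZ; first by rewrite divr_ge0.
apply: int_bound_sum => i; apply: int_bound_sum => l.
have [m i1] := integral_block_term_le sg1 ab cosn0 tan1 (i * (k./2 + 4)) l (J - l) (k./2 + 4).
split => //.
move=> s; apply: Int_ge0; last by move=> y _; rewrite !mulr_ge0 ?riesz_ge0 ?dyadic_ge0.
- by apply: cont_comp; [exact: continuous_block_term|exact: continuous_lin].
- exact: exp4V_le1.
Qed.

(** Since [2 ^- k * 2 ^- (k0 - k) = 2 ^- k0], every [k] has the same exponential order. One factor
    [k0 + 1] counts the values of [k], the other bounds the number of depths [l]. *)
Lemma int_bound_majorant k0 :
  int_bound (fun s => majorant k0 (tan (sg * s + c))) (2402 * k0.+1%:R ^+ 2 / 2 ^+ k0).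
Proof.
have c0 k : 0 <= 2 ^- k :> R by rewrite invr_ge0 exprn_ge0.
have [m p H] := int_boundD (int_bound_cst (c0 k0)) (int_bound_sum (fun k : 'I_k0.+1 =>
  int_boundZ (c0 k) (int_bound_summand (leq_ord k)))).
split => //; apply: le_trans H _; rewrite lee_fin.
apply: (@le_trans _ _ (2 ^- k0 * 2 + \sum_(k < k0.+1) 2400 * k0.+1%:R / 2 ^+ k0)).
  apply: lerD; first by rewrite ler_wpM2l ?invr_ge0 ?exprn_ge0.
  apply: ler_sum => k _; have kk0 : (k <= k0)%N by rewrite -ltnS.
  have -> : 2 ^+ k0 = 2 ^+ k * 2 ^+ (k0 - k) :> R by rewrite -exprD subnKC.
  have : (k0 - k).+1%:R <= k0.+1%:R :> R by rewrite ler_nat ltnS leq_subr.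
  have xy : 0 <= 2 ^- k * 2 ^- (k0 - k) :> R by rewrite mulr_ge0 ?invr_ge0 ?exprn_ge0.
  move=> /(ler_wpM2r xy); rewrite invfM.
  by move: (2 ^- k) (2 ^- (k0 - k)) ((k0 - k).+1%:R) (k0.+1%:R) => x y u v; lra.
rewrite sumr_const card_ord -[X in _ + X]mulr_natl.
have k1 : 1 <= k0.+1%:R :> R by rewrite ler1n.
have : 0 <= 2 ^- k0 :> R by rewrite invr_ge0 exprn_ge0.
rewrite (_ : k0.+1%:R * (2400 * k0.+1%:R / 2 ^+ k0) = 2400 * k0.+1%:R ^+ 2 * 2 ^- k0); last by ring.
by move: (2 ^- k0) => x x0; nra.
Qed.

End bounds.
End majorant.

(** * From covers by words to projections of the neighborhood *)

Section geometry.
Variable R : realType.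
Local Notation mu := (@lebesgue_measure R).

Lemma pos_cons t d w : pos t (d :: w) = (dval t d + pos t w) / 4 :> R.
Proof. by rewrite /pos /= exprS; field; rewrite exp4_neq0. Qed.

(** The starting index [m] is general so that the coarsest digit can be peeled off; the factor 3 is
    the nonzero digit. *)
Lemma corners_word m n (c1 c2 : R) :
  (\big[@minkowski_sum R/[set 0]]_(m.+1 <= k < (m + n).+1)
     [set 4 ^- k * a | a in @digits R]) c1 ->
  (\big[@minkowski_sum R/[set 0]]_(m.+1 <= k < (m + n).+1)
     [set 4 ^- k * a | a in @digits R]) c2 ->
  exists2 w, size w = n & forall t, c1 + t * c2 = 3 * 4 ^- m * pos t w.
Proof.
elim: n m c1 c2 => [|n IH] m c1 c2.
  rewrite addn0 big_geq // => -> ->; exists [::] => // t.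
  by rewrite /pos /= mul0r !mulr0 addr0.
rewrite big_ltn ?ltnS ?addnS ?leq_addr //.
have dig (x : R) : [set 4 ^- m.+1 * a | a in @digits R] x ->
    exists bb : bool, x = 3 * 4 ^- m.+1 * bb%:R.
  move=> [a [->|->] <-]; first by exists false; rewrite mulr0 mulr0.
  by exists true; rewrite mulr1 mulrC.
move=> [x1 /dig[b1 ->]] [y1 h1 <-] [x2 /dig[b2 ->]] [y2 h2 <-].
have [||w wn H] := IH m.+1 y1 y2; rewrite ?addSn //.
exists ((b1, b2) :: w) => [|t]; first by rewrite /= wn.
rewrite pos_cons /dval /= exprS invfM.
have := H t; rewrite exprS invfM; lra.
Qed.

Lemma lebesgue_le_cover (S : set R) (s : seq (R * R)) :
  all (fun i : R * R => 0 <= i.2) s ->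
  (forall x, S x -> exists2 i, i \in s & `|x - i.1| <= i.2) ->
  (mu S <= (2 * \sum_(i <- s) i.2)%:E)%E.
Proof.
move=> s0 sS.
pose U := \big[setU/set0]_(i <- s) `[i.1 - i.2, i.1 + i.2]%classic.
have mU : measurable U by apply: bigsetU_measurable => i _.
apply: (@le_trans _ _ (mu U)).
  rewrite /lebesgue_measure /lebesgue_stieltjes_measure /measure_extension.
  (* [S] may fail to be measurable, so monotonicity is that of the outer measure. *)
  apply: le_mu_ext => x /sS [i si xi]; rewrite /U -bigcup_seq; exists i => //=.
  by rewrite in_itv /= -ler_distl.
rewrite {mU sS}/U; elim: s s0 => [|i s IH] /=.
  by rewrite !big_nil measure0 mulr0.
move=> /andP[i0 s0]; rewrite !big_cons.
apply: le_trans (measureU2 _ _ _) _ => //.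
  by apply: bigsetU_measurable => j _.
rewrite mulrDr EFinD; apply: leeD; last exact: IH.
rewrite /= lebesgue_measure_itv /= lte_fin; case: ifPn => _.
  by rewrite -EFinB lee_fin; lra.
by rewrite lee_fin mulr_ge0.
Qed.

Lemma eucl_dist_bound (x y : R * R) d : eucl_dist x y < d ->
  `|x.1 - y.1| <= d /\ `|x.2 - y.2| <= d.
Proof.
rewrite /eucl_dist => h.
have d0 : 0 < d by apply: le_lt_trans h; exact: sqrtr_ge0.
by split; rewrite -sqrtr_sqr; apply: le_trans (ltW h); rewrite ler_sqrt ?addr_ge0 ?sqr_ge0 //;
  rewrite ?lerDl ?lerDr sqr_ge0.
Qed.

(** Two coordinates of the displacement to the Cantor set and two of the position inside a square
    give four errors of size [4 ^- n], divided by 3. *)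
Lemma nbhd_word n (x : R * R) : (0 < n)%N ->
  nbhd (4 ^- n) (@four_corner_cantor R) x ->
  exists2 w1 : seq digit, size w1 = n &
  (forall t, `|t| <= 1 -> `|(x.1 + t * x.2) / 3 - pos t w1| <= 3 / 4 ^+ n).
Proof.
move=> n0 /ereal_inf_lt[_ [y Ky <-]]; rewrite lte_fin => /eucl_dist_bound[d1 d2].
have [[c1 c2] [/= k1 k2] [[e1 e2] /= [i1 i2] ye]] := Ky n n0.
have [w wn H] := @corners_word 0 n c1 c2 k1 k2.
exists w => // t t1.
have := H t; rewrite expr0 invr1 mulr1 => Ht.
have -> : (x.1 + t * x.2) / 3 - pos t w = (x.1 - y.1 + t * (x.2 - y.2) + e1 + t * e2) / 3.
  rewrite -ye /=; have -> : pos t w = (c1 + t * c2) / 3 by rewrite Ht; field.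
  by field.
move: i1 i2; rewrite !in_itv /= => /andP[e10 e11] /andP[e20 e21].
have A : `|t * (x.2 - y.2)| <= 4 ^- n.
  by rewrite normrM; apply: le_trans d2; rewrite ler_piMl.
have B : `|t * e2| <= 4 ^- n.
  by rewrite normrM (ger0_norm e20); apply: le_trans e21; rewrite ler_piMl.
move: d1 A B; rewrite !ler_norml => /andP[? ?] /andP[? ?] /andP[? ?].
by apply/andP; split; lra.
Qed.

Lemma symm_swap n (x : R * R) :
  nbhd (4 ^- n) (@four_corner_cantor R) x ->
  nbhd (4 ^- n) (@four_corner_cantor R) (x.2, x.1).
Proof.
move=> /ereal_inf_lt[_ [y Ky <-]] xy; apply: le_lt_trans xy.
apply: ereal_inf_lbound; exists (y.2, y.1).
  move=> k k1; have [[c1 c2] [/= k3 k2] [[e1 e2] /= [i1 i2] ye]] := Ky k k1.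
  by exists (c2, c1) => //; exists (e2, e1) => //; rewrite -ye.
by rewrite /eucl_dist /= addrC.
Qed.

(** The diagonal symmetry [symm_swap] reduces steep directions to slopes at most 1. The 6 is 2, from
    radius to length, times 3, as [pos] is a third of the projection. *)
Lemma proj_measure_le n (al t B : R) (theta : R * R) : (0 < n)%N ->
  `|al| <= 1 -> `|t| <= 1 -> covered t n B ->
  theta = (al, al * t) \/ theta = (al * t, al) ->
  (mu (pi_theta theta @` nbhd (4 ^- n) (@four_corner_cantor R)) <= (6 * B)%:E)%E.
Proof.
move=> n0 al1 t1 [s [s0 sB H]] th.
pose s' := [seq (3 * al * i.1, 3 * i.2) | i : R * R <- s].
have -> : 6 * B = 2 * (3 * B) by ring.
apply: (@le_trans _ _ (2 * \sum_(i <- s') i.2)%:E); last first.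
  by rewrite lee_fin ler_pM2l // big_map -mulr_sumr ler_pM2l.
apply: lebesgue_le_cover.
  by apply/allP => i /mapP[j /(allP s0) j0 ->] /=; rewrite mulr_ge0.
have main (x : R * R) : nbhd (4 ^- n) (@four_corner_cantor R) x ->
    exists2 i, i \in s' & `|al * (x.1 + t * x.2) - i.1| <= i.2.
  move=> /(nbhd_word n0)[w wn /(_ t t1) Hw].
  have /hasP[i si zi] := H _ _ wn Hw.
  exists (3 * al * i.1, 3 * i.2); first exact: map_f.
  rewrite /= (_ : _ - _ = 3 * (al * ((x.1 + t * x.2) / 3 - i.1))); last by field.
  rewrite normrM ger0_norm // ler_pM2l // normrM.
  by apply: le_trans zi; rewrite ler_piMl.
move=> _ [x Kx <-]; case: th => ->.
- have [i si] := main x Kx; exists i => //.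
  by rewrite /pi_theta /= (_ : _ + _ = al * (x.1 + t * x.2)) //; ring.
- have [i si] := main _ (symm_swap Kx); exists i => //.
  by rewrite /pi_theta /= (_ : _ + _ = al * (x.2 + t * x.1)) //; ring.
Qed.

End geometry.

(** * The Favard length as a sum over five arcs *)

Section favard.
Variable R : realType.
Local Notation mu := (@lebesgue_measure R).

Lemma measurable_circle_param : measurable_fun setT (@circle_param R).
Proof.
apply: measurable_fun_pair; apply: continuous_measurable_fun.
- exact: continuous_cos.
- exact: continuous_sin.
Qed.

Import HBNNSimple.

(* No measurability of the projected lengths is required: the integral of a
   nonnegative function is a supremum over the simple functions below it. *)
Lemma Fav_le (E : set (R * R)) (H : R -> \bar R) : measurable_fun setT H ->
  (forall s, 0 <= H s)%E ->
  (forall s, mu (pi_theta (circle_param s) @` E) <= H s)%E ->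
  (Fav E <= (2 * pi)^-1%:E * \int[mu]_(s in `[0%R, (2 * pi)%R]) H s)%E.
Proof.
move=> mH H0 EH.
have -> : ((2 * pi)^-1%:E * \int[mu]_(s in `[0%R, (2 * pi)%R]) H s =
           \int[uniform_prob (@twopi_gt0 R)]_s H s)%E.
  by rewrite integral_uniform // subr0.
rewrite /Fav /sigma1 ge0_integralE //; first exact: measurable_circle_param.
move=> mphi; apply/ge_ereal_sup => _ /= [h hE <-].
rewrite -integralT_nnsfun ge0_integral_pushforward //.
- rewrite preimage_setT; apply: ge0_le_integral => //.
  + by move=> s _; rewrite lee_fin.
  + apply: (@measurableT_comp _ _ _ _ _ _ (fun y => (h y)%:E)) => //.
    exact/measurable_EFinP.
  + move=> s _; apply: le_trans (EH s); apply: le_trans (hE (circle_param s)) _.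
    rewrite patchE mem_set //; exact: cos2Dsin2.
- exact/measurable_EFinP.
- by move=> y _; rewrite lee_fin.
Qed.

Variable e : nat.
Hypothesis e37 : (37 <= e)%N.

(* On the [j]-th arc, [tan (arc_sign j * s + arc_shift j)] is [tan s] for even [j] and [cot s] for
   odd [j]; the five arcs cover [[0, 2 pi]]. *)
Definition arc_sign (j : nat) : R := if odd j then -1 else 1.
Definition arc_shift (j : nat) : R := if odd j then pi / 2 else 0.
Definition arcL (j : nat) : R := j%:R * (pi / 2) - pi / 4.
Definition arcR (j : nat) : R := j%:R * (pi / 2) + pi / 4.

Lemma arc_sign_norm j : `|arc_sign j| = 1.
Proof. by rewrite /arc_sign; case: ifP; rewrite ?normrN1 ?normr1. Qed.

Lemma arc_lt j : arcL j < arcR j.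
Proof. by rewrite /arcL /arcR; have := pi_gt0 R; lra. Qed.

Lemma arc_length j : arcR j - arcL j <= 2.
Proof. by rewrite /arcL /arcR; have := pihalf_lt2 R; lra. Qed.

Lemma cos_subpi (x : R) i : cos (x - i%:R * (2 * pi)) = cos x.
Proof.
elim: i => [|i IH]; first by rewrite mul0r subr0.
rewrite -IH -cosD2pi; congr cos; rewrite -natr1 mulr2n; ring.
Qed.

Lemma arc_cos j s : arcL j <= s <= arcR j -> 1 / 2 <= cos (arc_sign j * s + arc_shift j) ^+ 2.
Proof.
rewrite /arcL /arcR => /andP[s1 s2].
set x := arc_sign j * s + arc_shift j.
have c2 : 0 <= cos (2 * x).
  pose i := j./2.
  have jE : j%:R = (odd j)%:R + 2 * i%:R :> R.
    by rewrite -{1}(odd_double_half j) natrD -mul2n natrM.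
  rewrite jE in s1 s2; rewrite /x /arc_sign /arc_shift; case: (odd j) s1 s2 => /= s1 s2.
    rewrite -cosN -(cos_subpi _ i); apply: cos_ge0_pihalf.
    by apply/andP; split; lra.
  rewrite -(cos_subpi _ i); apply: cos_ge0_pihalf.
  by apply/andP; split; lra.
by move: c2; rewrite mulr_natl cos_mulr2n mulr2n; lra.
Qed.

Lemma arc_cosn0 j s : arcL j <= s <= arcR j -> cos (arc_sign j * s + arc_shift j) != 0.
Proof.
move=> /arc_cos h; apply/eqP => c0; move: h; rewrite c0 expr0n /=; lra.
Qed.

Lemma arc_tan j s : arcL j <= s <= arcR j -> `|tan (arc_sign j * s + arc_shift j)| <= 1.
Proof.
move=> sj; have c0 := arc_cosn0 sj; have := arc_cos sj.
rewrite /tan; set x := _ + _ => h.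
rewrite -(@expr_le1 _ 2) // real_normK ?num_real // expr_div_n ler_pdivrMr; last by lra.
by rewrite mul1r; have := cos2Dsin2 x; lra.
Qed.

Lemma arc_cover (s : R) : 0 <= s <= 2 * pi -> exists2 j : 'I_5, True & arcL j <= s <= arcR j.
Proof.
rewrite /arcL /arcR => /andP[s0 s1]; have := pi_gt0 R => p0.
have o0 : (0 < 5)%N by []. have o1 : (1 < 5)%N by []. have o2 : (2 < 5)%N by [].
have o3 : (3 < 5)%N by []. have o4 : (4 < 5)%N by [].
have [h0|h0] := leP s (pi / 4); first by exists (Ordinal o0) => //=; apply/andP; split; lra.
have [h1|h1] := leP s (pi / 2 + pi / 4); first by exists (Ordinal o1) => //=; apply/andP; split; lra.
have [h2|h2] := leP s (pi + pi / 4); first by exists (Ordinal o2) => //=; apply/andP; split; lra.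
have [h3|h3] := leP s (3 * (pi / 2) + pi / 4); first by exists (Ordinal o3) => //=; apply/andP; split; lra.
by exists (Ordinal o4) => //=; apply/andP; split; lra.
Qed.

Definition arc_bound k0 j s : R := 144 * majorant e k0 (tan (arc_sign j * s + arc_shift j)).

Lemma arc_bound_ge0 k0 j s : 0 <= arc_bound k0 j s.
Proof.
rewrite mulr_ge0 //; apply: le_trans (majorant_ge_last e k0 _).
by rewrite invr_ge0 exprn_ge0.
Qed.

Lemma proj_le_arc_bound n k0 j s : (0 < n)%N -> (nstages e k0 <= n)%N ->
  arcL j <= s <= arcR j ->
  (mu (pi_theta (circle_param s) @` nbhd (4 ^- n) (@four_corner_cantor R)) <=
   (arc_bound k0 j s)%:E)%E.
Proof.
move=> n0 kn sj; have t1 := arc_tan sj.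
have cov := covered_mono t1 kn (covered_majorant e37 k0 t1).
rewrite /arc_bound (_ : 144 * _ = 6 * (24 * majorant e k0 (tan (arc_sign j * s + arc_shift j)))); last by ring.
apply: (proj_measure_le (al := cos (arc_sign j * s + arc_shift j)) n0 _ t1 cov); first exact: cos_max.
have c0 := arc_cosn0 sj; set x := arc_sign j * s + arc_shift j in c0 *.
have ts : cos x * tan x = sin x by rewrite /tan mulrCA mulfV // mulr1.
rewrite ts /circle_param /x /arc_sign /arc_shift; case: (odd j).
  right; rewrite mulN1r addrC; congr (_, _).
    by rewrite sinB sin_pihalf cos_pihalf; ring.
  by rewrite cosB sin_pihalf cos_pihalf; ring.
by left; rewrite mul1r addr0.
Qed.

Lemma Fav_nbhd_le n k0 : (0 < n)%N -> (nstages e k0 <= n)%N ->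
  (Fav (nbhd (4 ^- n) (@four_corner_cantor R)) <=
   (5 * (144 * (2402 * k0.+1%:R ^+ 2 / 2 ^+ k0)))%:E)%E.
Proof.
move=> n0 kn.
pose D : set R := `[0, 2 * pi]%classic.
pose A j : set R := `[arcL j, arcR j]%classic.
pose Hj (j : 'I_5) (s : R) : \bar R := ((fun s => (arc_bound k0 j s)%:E) \_ (A j)) s.
(* [Fav_le] asks for a bound at every [s]; the value [+oo] outside [[0, 2 pi]] provides it without
   changing the integral. *)
pose Hoo (s : R) : \bar R := ((cst +oo%E) \_ (~` D)) s.
pose H (s : R) : \bar R := (\sum_(j < 5) Hj j s + Hoo s)%E.
have b144 j := int_boundZ (_ : 0 <= 144) (int_bound_majorant e (arc_lt j) (arc_sign_norm j) (@arc_cosn0 j)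
  (@arc_tan j) (arc_length j) k0).
have {}b144 := b144 (ler0n _ 144).
have Hj0 j s : (0 <= Hj j s)%E.
  by apply: erestrict_ge0 => x _; rewrite lee_fin arc_bound_ge0.
have Hoo0 s : (0 <= Hoo s)%E by apply: erestrict_ge0 => x _; exact: leey.
have mA j : measurable (A j) by exact: measurable_itv.
have mD : measurable D by exact: measurable_itv.
have mHj j : measurable_fun setT (Hj j).
  by have [m _ _] := b144 j; exact: ((measurable_restrictT _ (mA j)).1 m).
have mHoo : measurable_fun setT Hoo.
  exact: ((measurable_restrictT _ (measurableC mD)).1 (measurable_cst _)).
have mS : measurable_fun setT ((fun s => (\sum_(j < 5) Hj j s)%E) : R -> \bar R).
  by apply: emeasurable_sum.
have mH : measurable_fun setT H by apply: emeasurable_funD.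
have H0 s : (0 <= H s)%E by rewrite adde_ge0 // sume_ge0.
apply: le_trans (Fav_le mH H0 _) _.
  move=> s; have [sD|sD] := boolP (s \in D); last first.
    rewrite /H /Hoo patchE mem_set /= ?addey ?leey //.
      by rewrite gt_eqF // (lt_le_trans ltNy0) // sume_ge0.
    by move=> h; move/negP: sD; apply; rewrite inE.
  have [j _ sj] : exists2 j : 'I_5, True & arcL j <= s <= arcR j.
    by apply: arc_cover; move: sD; rewrite inE /D /= in_itv.
  apply: le_trans (proj_le_arc_bound n0 kn sj) _.
  rewrite /H (bigD1 j) //= -addeA {1}/Hj patchE mem_set /=; last by rewrite /A /= in_itv.
  by rewrite leeDl // adde_ge0 // sume_ge0.
set X := 144 * _.
have X0 : 0 <= X := mulr_ge0 (ler0n R 144) (divr_ge0 (mulr_ge0 (ler0n R 2402) (sqr_ge0 _))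
  (exprn_ge0 k0 (ler0n R 2))).
have IH : (\int[mu]_(s in D) H s <= (5 * X)%:E)%E.
  have S0 s : D s -> (0 <= \sum_(j < 5) Hj j s)%E by move=> _; rewrite sume_ge0.
  rewrite (ge0_integralD mu mD S0 (measurable_funTS mS) (fun s _ => Hoo0 s)
    (measurable_funTS mHoo)).
  have -> : (\int[mu]_(s in D) Hoo s = 0)%E.
    apply: integral0_eq => s Ds; have nDs : ~ (~` D) s by move=> h; exact: (h Ds).
    by rewrite /Hoo patchE (memNset nDs).
  rewrite adde0.
  rewrite (ge0_integral_sum mu mD (fun j => measurable_funTS (mHj j)) (fun j s _ => Hj0 j s)).
  rewrite (_ : (5 * X)%:E = \sum_(j < 5) X%:E)%E; last first.
    by rewrite sumEFin sumr_const card_ord -[in RHS]mulr_natl.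
  apply: lee_sum => j _; have [_ _ b] := b144 j.
  apply: le_trans b; rewrite [leRHS]integral_mkcond.
  apply: ge0_subset_integral; [exact: mD|exact: measurableT|exact: mHj| |exact: subsetT].
  by move=> s _; exact: Hj0.
clearbody X.
have p1 : (2 * pi)^-1 <= 1 :> R.
  by rewrite invf_le1 ?mulr_gt0 ?pi_gt0 //; have := pi_ge2 R; lra.
have p0 : 0 <= (2 * pi)^-1 :> R by rewrite invr_ge0 mulr_ge0 ?pi_ge0.
apply: le_trans (lee_wpmul2l (_ : (0 <= (2 * pi)^-1%:E)%E) IH) _; first by rewrite lee_fin.
rewrite -EFinM lee_fin; have : 0 <= 5 * X by exact: mulr_ge0.
by move: ((2 * pi)^-1) p0 p1 => y y0 y1 X5; nra.
Qed.

End favard.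

(** * From the discrete stages to all [N] *)

Lemma nstages_bracket e N : (0 < N)%N ->
  exists k, [/\ (nstages e k <= N)%N, (2 ^ k <= N)%N & (N < nstages e k.+1)%N].
Proof.
move=> N0.
have ge2 k : (0 < k)%N -> (2 ^ k <= nstages e k)%N.
  move=> k0; rewrite /nstages /nblocks (_ : 24 * 2 ^ k * k * _ =
    2 ^ k * (24 * k * (2 ^ e * 16 ^ k * (k + 4))))%N; last by ring.
  by rewrite leq_pmulr // !muln_gt0 !expn_gt0 k0 addn_gt0 k0.
(* The factor [k0] in [nstages] makes it 0 at 0, so every [N] has a bracket. *)
have ex0 : exists k, (nstages e k <= N)%N by exists 0%N; rewrite /nstages muln0.
have bnd k : (nstages e k <= N)%N -> (k <= N)%N.
  case: k => // k kN; apply: leq_trans kN; apply: leq_trans _ (ge2 k.+1 isT).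
  exact/ltnW/ltn_expl.
have [k kN kmax] := ex_maxnP ex0 bnd.
exists k; split => //.
  case: k kN {kmax} => [|k] kN; first by rewrite expn0.
  exact: leq_trans (ge2 k.+1 isT) kN.
by rewrite ltnNge; apply/negP => /kmax; rewrite ltnn.
Qed.

Section asymptotics.
Variables (R : realType) (u : R) (e : nat).
Hypothesis u0 : 0 < u.

Let A : R := 24 * 32 * 5 * 2 ^+ e.

Lemma nstages_le k : (nstages e k.+1)%:R <= A * k.+1%:R ^+ 2 * 32 ^+ k.
Proof.
rewrite /nstages /nblocks !natrM !natrX natrD /A !exprS expr0.
rewrite (_ : 32 ^+ k = 2 ^+ k * 16 ^+ k); last by rewrite -exprMn -natrM.
have k1 : 1 <= k.+1%:R :> R by rewrite ler1n.
have : 0 <= 2 ^+ k * 2 ^+ e * 16 ^+ k :> R by rewrite !mulr_ge0 ?exprn_ge0.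
set x := 2 ^+ k; set y := 2 ^+ e; set z := 16 ^+ k; set j := k.+1%:R in k1 *.
move=> p0.
have : (x * y * z) * (j * (j + 4)) <= (x * y * z) * (j * (5 * j)).
  apply: ler_wpM2l => //; apply: ler_wpM2l; lra.
by lra.
Qed.

(** Chosen so that [k + 1 <= D * expR y] with [y = u * k * ln 2 / 3], by [1 + y <= expR y]. *)
Let D : R := 1 + 3 / (u * ln 2).

(* As [N] lies between [2 ^ k] and a multiple of [(k + 1) ^ 2 * 32 ^ k], the factor
   [N ^ u] absorbs the powers of [k]. *)
Lemma decay_le N k : (0 < N)%N -> (2 ^ k <= N)%N -> (N < nstages e k.+1)%N ->
  k.+1%:R ^+ 2 / 2 ^+ k <= A * D ^+ 3 * powR N%:R (- (1 / 5) + u).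
Proof.
move=> N0 kN Nk.
have NR : 0 < N%:R :> R by rewrite ltr0n.
have l2 : 0 < ln 2 :> R by rewrite ln_gt0 // ltr1n.
have A1 : 1 <= A.
  have : 1 <= 2 ^+ e :> R by rewrite exprn_ege1 // ler1n.
  by rewrite /A; lra.
have A0 : 0 < A by exact: lt_le_trans A1.
set X : R := k.+1%:R.
have X1 : 1 <= X by rewrite ler1n.
have X0 : 0 < X by exact: lt_le_trans X1.
set L : R := ln N%:R.
have Lge : k%:R * ln 2 <= L.
  rewrite mulr_natl -lnXn // ler_ln ?posrE ?exprn_gt0 //.
  by rewrite -natrX ler_nat.
have Lle : L <= ln A + 2 * ln X + 5 * (k%:R * ln 2).
  have : L <= ln (A * X ^+ 2 * 32 ^+ k).
    rewrite ler_ln ?posrE ?mulr_gt0 ?exprn_gt0 //.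
    by apply: le_trans (nstages_le k); rewrite ler_nat ltnW.
  rewrite !lnM ?posrE ?mulr_gt0 ?exprn_gt0 // !lnXn //.
  rewrite (_ : 32 = 2 ^+ 5 :> R); last by rewrite -natrX.
  by rewrite lnXn // !mulr_natl -!mulrnA mulnC; lra.
have lA : 0 <= ln A by rewrite ln_ge0.
have lX : 0 <= ln X by rewrite ln_ge0.
(* The fifths of [ln A] and [2 * ln X] are rounded up to [ln A] and [ln X]. This loses one more
   power of [X], so [X ^ 3] has to be absorbed, hence the thirds in [y]. *)
have key : - ln A - ln X - k%:R * ln 2 + u * (k%:R * ln 2) <= (- (1 / 5) + u) * L.
  have : u * (k%:R * ln 2) <= u * L by rewrite ler_pM2l.
  by lra.
rewrite /powR gt_eqF // -/L.
set y := u * (k%:R * ln 2) / 3.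
have y0 : 0 <= y by rewrite divr_ge0 // !mulr_ge0 // ltW.
have XD : X <= D * expR y.
  have D0 : 0 <= D by rewrite addr_ge0 // divr_ge0 // mulr_ge0 // ltW.
  apply: le_trans (ler_wpM2l D0 (expR_ge1Dx y)).
  have ul : u * ln 2 != 0 by rewrite mulf_neq0 ?gt_eqF.
  have e1 : 3 / (u * ln 2) * y = k%:R.
    rewrite /y; field; move: ul; rewrite mulf_eq0 negb_or => /andP[-> ->] //.
  have -> : D * (1 + y) = D + y + 3 / (u * ln 2) * y by rewrite /D; ring.
  rewrite e1 /X -natr1 /D; have : 0 <= 3 / (u * ln 2) by rewrite divr_ge0 // mulr_ge0 // ltW.
  by lra.
have X3 : X ^+ 3 <= D ^+ 3 * expR (u * (k%:R * ln 2)).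
  have -> : expR (u * (k%:R * ln 2)) = expR y ^+ 3.
    by rewrite -expRM_natl; congr expR; rewrite /y; field.
  by rewrite -exprMn lerXn2r // ?nnegrE; [exact: ltW|exact: le_trans XD; exact: ltW].
have : A * D ^+ 3 * expR (- ln A - ln X - k%:R * ln 2 + u * (k%:R * ln 2)) <=
       A * D ^+ 3 * expR ((- (1 / 5) + u) * L).
  apply: ler_wpM2l; last by rewrite ler_expR.
  by rewrite mulr_ge0 ?(ltW A0) // exprn_ge0 // addr_ge0 // divr_ge0 // mulr_ge0 // ltW.
apply: le_trans.
have -> : expR (- ln A - ln X - k%:R * ln 2 + u * (k%:R * ln 2)) =
    A^-1 * X^-1 * 2 ^- k * expR (u * (k%:R * ln 2)).
  rewrite !expRD !expRN !lnK ?posrE // mulr_natl -lnXn // lnK ?posrE ?exprn_gt0 //.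
rewrite (_ : A * D ^+ 3 * _ = X^-1 * 2 ^- k * (D ^+ 3 * expR (u * (k%:R * ln 2)))); last first.
  by field; rewrite !gt_eqF // exprn_gt0.
rewrite (_ : X ^+ 2 / 2 ^+ k = X^-1 * 2 ^- k * X ^+ 3); last first.
  by field; rewrite !gt_eqF // exprn_gt0.
by apply: ler_wpM2l => //; rewrite mulr_ge0 ?invr_ge0 ?exprn_ge0 // ltW.
Qed.

Lemma Fav_decay : (37 <= e)%N -> exists (C : R) (N0 : nat), forall N : nat, (N0 <= N)%N ->
  (Fav (nbhd (4 ^- N) (@four_corner_cantor R)) <=
   (C * powR N%:R (- (1 / 5) + u))%:E)%E.
Proof.
move=> e37; exists (5 * (144 * (2402 * (A * D ^+ 3)))), 1%N => N N0.
have [k [kN k2 Nk]] := nstages_bracket e N0.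
have H := @Fav_nbhd_le R e e37 N k N0 kN. apply: le_trans H _.
rewrite lee_fin; have := decay_le N0 k2 Nk.
by move: (k.+1%:R ^+ 2) (2 ^- k) (A * D ^+ 3) (powR _ _) => x y z w; lra.
Qed.

End asymptotics.

Theorem theorem1p2 (R : realType) (u : R) (hu : 0 < u) :
  exists (C : R) (N0 : nat), forall N : nat, (N0 <= N)%N ->
    (Fav (nbhd (4 ^- N) (@four_corner_cantor R))
       <= (C * powR N%:R (- (1 / 5) + u))%:E)%E.
Proof. exact: Fav_decay hu (leqnn 37). Qed.
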